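(* Let $N\ge 2$, $n\ge 1$, let $\mathcal G$ be a strongly connected and weight-balanced digraph on $\{1,\dots,N\}$ with adjacency matrix $(a_{ij})$ and Laplacian $L$, and let $\hat\lambda_2$ be the second smallest eigenvalue of $\frac{L+L^T}{2}$. For each $i\in\{1,\dots,N\}$ let $\Omega_i\subset\mathbb R^n$ be closed and convex, let $d_i\in\mathbb R^n$, and let $f_i$ be a convex (possibly nonsmooth) real-valued function on $\mathbb R^n$ which is $\omega$-strongly convex on $\Omega_i$, with a constant $\omega>0$. Assume Slater's condition: there exist $x_i\in \mathrm{int}(\Omega_i)$, $i=1,\dots,N$, with $\sum_{i=1}^N x_i=\sum_{i=1}^N d_i$. Let $$k_1>\frac{\|L\|^2}{\hat\lambda_2\,\omega},\qquad k_2>\frac{k_1^2}{\hat\lambda_2^2},\qquad k_3>0 .$$ Consider, for $i\in\{1,\dots,N\}$, the dynamics $$\begin{cases}\dot x_i\in \Pi_{\Omega_i}\big(x_i,-\partial f_i(x_i)+\mu_i\big),\quad x_i(0)\in\Omega_i,\\ \dot\mu_i=k_1(\eta_i-x_i+d_i)-k_2\sum_{j=1}^N a_{ij}(\mu_i-\mu_j),\\ \dot\eta_i=-k_3\sum_{j=1}^N a_{ij}\big((\eta_i-x_i+d_i)-(\eta_j-x_j+d_j)\big).\end{cases}$$ Then every trajectory $(x(t),\mu(t),\eta(t))$ of these dynamics, with $x=(x_1,\dots,x_N)$, $\mu=(\mu_1,\dots,\mu_N)$, $\eta=(\eta_1,\dots,\eta_N)$, starting from any initial state with $x_i(0)\in\Omega_i$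 for all $i$ and $\sum_{i=1}^N\eta_i(0)=0_n$, converges as $t\to\infty$ to an equilibrium point of the dynamics, and $x(t)$ converges as $t\to\infty$ to the optimal solution of the problem $$\min_{x\in\mathbb R^{Nn}}\ \sum_{i=1}^N f_i(x_i)\quad\text{subject to}\quad \sum_{i=1}^N x_i=\sum_{i=1}^N d_i,\quad x_i\in\Omega_i,\ i=1,\dots,N .$$
   Context: Digraph: $\mathcal G=(\mathcal V,\mathcal E,\mathcal A)$ with $\mathcal V=\{1,\dots,N\}$, $\mathcal A=(a_{ij})$, $a_{ij}>0$ if $(i,j)\in\mathcal E$ (agent $i$ receives information from agent $j$), $a_{ij}=0$ otherwise, $a_{ii}=0$. $\mathcal G$ is strongly connected if any two nodes are joined by a directed path, and weight-balanced if $\sum_{j}a_{ij}=\sum_j a_{ji}$ for all $i$. The Laplacian is $L=\mathrm{diag}(\sum_j a_{1j},\dots,\sum_j a_{Nj})-\mathcal A$. The eigenvalues of $\frac{L+L^T}{2}$ are ordered $\hat\lambda_1\le\dots\le\hat\lambda_N$. $\|L\|$ is the spectral norm. Convexity: $\partial f(u)=\{\gamma\in\mathbb R^n: f(v)\ge f(u)+\gamma^T(v-u)\ \forall v\in\mathbb R^n\}$. $f$ is $\omega$-strongly convex on $\Omega$ if $(u-v)^T(\gamma_1-\gamma_2)\ge\omega\|u-v\|^2$ for all $u,v\in\Omega$, $\gamma_1\in\partial f(u)$, $\gamma_2\in\partial f(v)$. $\mathrm{int}(\Omega)$ denotes the relative interior of $\Omega$. For a closed convex set $\Omega\subset\mathbb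 R^n$ and $u\in\Omega$: the normal cone is $\mathcal N_\Omega(u)=\{v: v^T(w-u)\le 0\ \forall w\in\Omega\}$; the tangent cone is its polar $T_\Omega(u)=\{v: v^Tw\le 0\ \forall w\in\mathcal N_\Omega(u)\}$; $P_\Omega$ is the Euclidean projection onto $\Omega$. The differentiated projection operator is $\Pi_\Omega(u,v)=\lim_{\varepsilon\to0^+}\frac{P_\Omega(u+\varepsilon v)-u}{\varepsilon}=P_{T_\Omega(u)}(v)$, and for a set $S$, $\Pi_\Omega(u,S)=\{\Pi_\Omega(u,v):v\in S\}$; $-\partial f_i(x_i)+\mu_i=\{-\gamma+\mu_i:\gamma\in\partial f_i(x_i)\}$. A trajectory (solution) is a (locally) absolutely continuous function on $[0,\infty)$ satisfying the differential inclusion for almost every $t$. An equilibrium point is a point $(x^*,\mu^*,\eta^* )$ with $x_i^*\in\Omega_i$ for all $i$ at which $0$ belongs to the right-hand side. *)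

(* Defs.v *)
From HB Require Import structures.
From mathcomp Require Import all_boot all_order all_algebra.
From mathcomp Require Import all_classical all_reals all_analysis.
Set Implicit Arguments.
Unset Strict Implicit.
Unset Printing Implicit Defensive.
Import Order.TTheory GRing.Theory Num.Theory.
Import numFieldNormedType.Exports.

Local Open Scope classical_set_scope.
Local Open Scope ring_scope.

(* Vectors of R^n are row vectors, and (x_1, ..., x_N) in R^{Nn} is the matrix
   x : 'M[R]_(N, n) with x_i = row i x.  The library norm on matrices is the
   max norm: it is used only for topological notions; metric ones (projection,
   strong convexity, spectral norm) use enorm below. *)

Section Euclidean.
Context {R : realType}.

Definition dotp n (u v : 'rV[R]_n) : R := (u *m v^T) 0 0.

Definition enorm n (u : 'rV[R]_n) : R := Num.sqrt (dotp u u).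

(* v *m A^T is the transpose of A *m v^T, so this is the operator norm of A
   acting on column vectors. *)
Definition spectral_norm m n (A : 'M[R]_(m, n)) : R :=
  sup [set enorm (v *m A^T) | v in [set v : 'rV[R]_n | enorm v <= 1]].

(* The real eigenvalues of M with multiplicity, in nondecreasing order; such an
   s exists only if the characteristic polynomial of M splits over R (e.g. M
   symmetric), and is then unique. *)
Definition ordered_eigenvalues n (M : 'M[R]_n) (s : seq R) : Prop :=
  sorted <=%R s /\ char_poly M = \prod_(a <- s) ('X - a%:P).

End Euclidean.

Section Digraph.

(* edge i j: agent i receives information from agent j. *)
Record wdigraph (R : realType) (N : nat) := WDigraph {
  edge : rel 'I_N;
  adj : 'M[R]_N;
  adj_gt0 : forall i j, edge i j -> 0 < adj i j;
  adj_eq0 : forall i j, ~~ edge i j -> adj i j = 0;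
  adj_diag : forall i, adj i i = 0 }.

Context {R : realType} {N : nat}.
Implicit Type G : wdigraph R N.

Definition strongly_connected G : Prop := forall i j, connect (edge G) i j.

Definition weight_balanced G : Prop :=
  forall i, \sum_j adj G i j = \sum_j adj G j i.

Definition laplacian G : 'M[R]_N :=
  diag_mx (\row_i \sum_j adj G i j) - adj G.

End Digraph.

Section ConvexAnalysis.
Context {R : realType} {n : nat}.
Implicit Types (A S : set 'rV[R]_n) (f : 'rV[R]_n -> R) (u v : 'rV[R]_n).

Definition subdiff f u : set 'rV[R]_n :=
  [set g | forall v, f u + dotp g (v - u) <= f v].

Definition strongly_convex_on (w : R) A f : Prop :=
  forall u v g1 g2, A u -> A v -> subdiff f u g1 -> subdiff f v g2 ->
    w * enorm (u - v) ^+ 2 <= dotp (u - v) (g1 - g2).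

Definition affine_set A : Prop :=
  forall u v (t : R), A u -> A v -> A ((1 - t) *: u + t *: v).

Definition affine_hull A : set 'rV[R]_n := smallest affine_set A.

Definition relint A : set 'rV[R]_n :=
  [set u | A u /\ \forall v \near u, affine_hull A v -> A v].

(* The (unique) Euclidean nearest point when A is nonempty, closed and convex;
   unspecified otherwise. *)
Definition eproj A v : 'rV[R]_n :=
  get [set p | A p /\ forall w, A w -> enorm (v - p) <= enorm (v - w)].

Definition dproj A u v : 'rV[R]_n :=
  lim ((fun e : R => e^-1 *: (eproj A (u + e *: v) - u)) @ 0^'+).

(* dproj A u is meaningful only at u in A; the set-valued operator is given
   no values elsewhere. *)
Definition dproj_set A u S : set 'rV[R]_n :=
  [set w | A u /\ exists2 v, S v & w = dproj A u v].

End ConvexAnalysis.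

Section AbsoluteContinuity.
Context {R : realType} {V : normedModType R}.

Definition abs_continuous_on (a b : R) (f : R -> V) : Prop :=
  forall e : R, 0 < e -> exists2 d : R, 0 < d &
    forall (k : nat) (u v : 'I_k -> R),
      (forall i, a <= u i /\ u i <= v i /\ v i <= b) ->
      trivIset [set: 'I_k] (fun i => `]u i, v i[%classic) ->
      \sum_(i < k) (v i - u i) < d ->
      \sum_(i < k) `|f (v i) - f (u i)| < e.

Definition locally_abs_continuous (f : R -> V) : Prop :=
  forall T : R, 0 < T -> abs_continuous_on 0 T f.

End AbsoluteContinuity.

Section Dynamics.
Context {R : realType} {N n : nat}.
Variables (G : wdigraph R N) (Omega : 'I_N -> set 'rV[R]_n).
Variables (f : 'I_N -> 'rV[R]_n -> R) (d : 'I_N -> 'rV[R]_n).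

Definition feasible (x : 'M[R]_(N, n)) : Prop :=
  \sum_i row i x = \sum_i d i /\ forall i, Omega i (row i x).

Definition optimal (x : 'M[R]_(N, n)) : Prop :=
  feasible x /\ forall y, feasible y ->
    \sum_i f i (row i x) <= \sum_i f i (row i y).

Definition slater : Prop :=
  exists2 x : 'M[R]_(N, n), \sum_i row i x = \sum_i d i &
    forall i, relint (Omega i) (row i x).

Variables k1 k2 k3 : R.

Definition dynamics_rhs (x mu eta : 'M[R]_(N, n)) :
    set ('M[R]_(N, n) * 'M[R]_(N, n) * 'M[R]_(N, n)) :=
  let r i := row i eta - row i x + d i in
  [set w | forall i,
    [/\ dproj_set (Omega i) (row i x)
          [set - g + row i mu | g in subdiff (f i) (row i x)] (row i w.1.1),
        row i w.1.2 =
          k1 *: r i - k2 *: \sum_j adj G i j *: (row i mu - row j mu)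
      & row i w.2 = - k3 *: \sum_j adj G i j *: (r i - r j)]].

Definition equilibrium (x mu eta : 'M[R]_(N, n)) : Prop :=
  (forall i, Omega i (row i x)) /\ dynamics_rhs x mu eta (0, 0, 0).

(* Only the values at t >= 0 matter (t = 0 is a null set for the derivatives). *)
Definition trajectory (x mu eta : R -> 'M[R]_(N, n)) : Prop :=
  [/\ locally_abs_continuous x,
      locally_abs_continuous mu,
      locally_abs_continuous eta,
      (forall i, Omega i (row i (x 0)))
    & {ae @lebesgue_measure R, forall t : R, 0 <= t ->
        [/\ derivable x t 1, derivable mu t 1, derivable eta t 1
          & dynamics_rhs (x t) (mu t) (eta t)
              (x^`()%classic t, mu^`()%classic t, eta^`()%classic t)]}].

End Dynamics.

(* Main.v *)
(* Let (xs, nu) be a saddle point: xs is feasible and each xs_i minimizes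
   f_i - <nu, .> over Omega_i.  With X = x - xs, M = mu - 1 (x) nu,
   E = eta - (xs - d), P the projection killing the agent average, l = |L| and
   lam the second eigenvalue, V = k1/2 |X|^2 + 1/2 |M|^2 + 1/k3 |E|^2 satisfies
   V' <= - (k1 omega - l^2/lam) |X|^2 - (k2 lam - k1^2/(2 lam)) |P M|^2
         - lam/2 |E|^2,
   and the gain conditions make the first two coefficients positive.  Only upper
   bounds on the derivatives of the squared norms are needed for Barbalat's
   argument, so X, P M and E vanish in the limit.  A cluster point of mu is then of
   the form 1 (x) nuh with (xs, nuh) again a saddle point, and V for (xs, nuh) is
   nonincreasing and arbitrarily small at some times, hence tends to 0.

   Absolutely continuous functions are only compared with affine ones (a function
   with a.e. derivative at most C grows at most at rate C), so no Lebesgue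
   integral occurs.  A saddle point exists by quadratic penalization of the
   coupling constraint, whose multipliers are bounded by Slater's condition; the
   subgradients come from the Hahn-Banach theorem in R^n. *)
Require Import Defs.
From HB Require Import structures.
From mathcomp Require Import all_boot all_order all_algebra.
From mathcomp Require Import all_classical all_reals all_analysis.
From mathcomp Require Import ring lra.
Set Implicit Arguments.
Unset Strict Implicit.
Unset Printing Implicit Defensive.
Import Order.TTheory GRing.Theory Num.Theory.
Import numFieldNormedType.Exports.

Local Open Scope classical_set_scope.
Local Open Scope ring_scope.

(** * Frobenius inner product *)

(** The dissipation of [V] does not see the agent average of [mu], and the multiplier of a saddle
    point need not be unique. So [V] at a saddle point fixed in advance need not tend to 0, which is
    why that saddle point is exchanged for one selected by the trajectory. The weights of [V] come
    from the cross terms: [k1 / 2] makes the two occurrences of [k1 <M, X>] cancel, and [1 / k3]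
    removes [k3] from the estimate. What remains is [k1 <M, E>], where [M] may be replaced by [P M]
    because [E] has zero agent sum, and [2 <E, L X>]; Young's inequality moves both onto the
    squares. The derivative of [x] enters only through inner products with [x_i - y] for [y] in
    [Omega_i], which the normal-cone inequality bounds from above. The estimates on [x] are
    therefore one-sided, and Barbalat's argument looks backward in time from a large value. *)

Section Frobenius.
Context {R : realType}.

Definition mdot m n (A B : 'M[R]_(m, n)) : R := \tr (A *m B^T).

Lemma mdotE m n (A B : 'M[R]_(m, n)) :
  mdot A B = \sum_i \sum_j A i j * B i j.
Proof.
by apply: eq_bigr => i _; rewrite mxE; apply: eq_bigr => j _; rewrite mxE.
Qed.

Lemma dotpE n (u v : 'rV[R]_n) : dotp u v = mdot u v.
Proof. by rewrite /mdot /dotp -trace_mx11. Qed.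

Lemma mdot_rows m n (A B : 'M[R]_(m, n)) :
  mdot A B = \sum_i mdot (row i A) (row i B).
Proof.
rewrite mdotE; apply: eq_bigr => i _; rewrite mdotE big_ord1.
by apply: eq_bigr => j _; rewrite !mxE.
Qed.

Lemma mdot_cols m n (A B : 'M[R]_(m, n)) :
  mdot A B = \sum_j mdot (col j A) (col j B).
Proof.
rewrite mdotE exchange_big; apply: eq_bigr => j _; rewrite mdotE.
by apply: eq_bigr => i _; rewrite big_ord1 !mxE.
Qed.

Lemma mdotC m n (A B : 'M[R]_(m, n)) : mdot A B = mdot B A.
Proof. by rewrite /mdot -mxtrace_tr trmx_mul trmxK. Qed.

Lemma mdot_tr m n (A B : 'M[R]_(m, n)) : mdot A^T B^T = mdot A B.
Proof. by rewrite (mdotC A B) /mdot trmxK mxtrace_mulC. Qed.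

Lemma mdotDl m n (A B C : 'M[R]_(m, n)) : mdot (A + B) C = mdot A C + mdot B C.
Proof. by rewrite /mdot mulmxDl linearD. Qed.

Lemma mdotDr m n (A B C : 'M[R]_(m, n)) : mdot C (A + B) = mdot C A + mdot C B.
Proof. by rewrite !(mdotC C) mdotDl. Qed.

Lemma mdotNl m n (A C : 'M[R]_(m, n)) : mdot (- A) C = - mdot A C.
Proof. by rewrite /mdot mulNmx linearN. Qed.

Lemma mdotNr m n (A C : 'M[R]_(m, n)) : mdot C (- A) = - mdot C A.
Proof. by rewrite !(mdotC C) mdotNl. Qed.

Lemma mdotZl m n a (A C : 'M[R]_(m, n)) : mdot (a *: A) C = a * mdot A C.
Proof. by rewrite /mdot -scalemxAl linearZ. Qed.

Lemma mdotZr m n a (A C : 'M[R]_(m, n)) : mdot C (a *: A) = a * mdot C A.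
Proof. by rewrite !(mdotC C) mdotZl. Qed.

Lemma mdot0l m n (A : 'M[R]_(m, n)) : mdot 0 A = 0.
Proof. by rewrite /mdot mul0mx linear0. Qed.

Lemma mdot0r m n (A : 'M[R]_(m, n)) : mdot A 0 = 0.
Proof. by rewrite mdotC mdot0l. Qed.

Definition mdot_lin := (mdotDl, mdotDr, mdotNl, mdotNr, mdotZl, mdotZr).

Lemma mdot_suml I (r : seq I) (Q : pred I) m n (A : I -> 'M[R]_(m, n)) C :
  mdot (\sum_(i <- r | Q i) A i) C = \sum_(i <- r | Q i) mdot (A i) C.
Proof.
by elim/big_rec2: _ => [|i x y _ <-]; rewrite ?mdot0l// mdotDl.
Qed.

Lemma mdotMl m n p (L : 'M[R]_(m, n)) (A : 'M[R]_(n, p)) B :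
  mdot (L *m A) B = mdot A (L^T *m B).
Proof. by rewrite /mdot trmx_mul trmxK mulmxA [RHS]mxtrace_mulC mulmxA. Qed.

Lemma mdot_ge0 m n (A : 'M[R]_(m, n)) : 0 <= mdot A A.
Proof. by rewrite mdotE !sumr_ge0// => i _; rewrite sumr_ge0// => j _; rewrite -expr2 sqr_ge0. Qed.

Lemma sqr_entry_le m n (A : 'M[R]_(m, n)) i j : A i j ^+ 2 <= mdot A A.
Proof.
rewrite mdotE (bigD1 i)//= (bigD1 j)//= -expr2 -addrA lerDl addr_ge0//.
  by rewrite sumr_ge0// => k _; rewrite -expr2 sqr_ge0.
by rewrite sumr_ge0// => k _; rewrite sumr_ge0// => l _; rewrite -expr2 sqr_ge0.
Qed.

Lemma mdot_eq0 m n (A : 'M[R]_(m, n)) : mdot A A = 0 -> A = 0.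
Proof.
move=> A0; apply/matrixP => i j; rewrite mxE; apply/eqP.
by rewrite -sqrf_eq0 eq_le sqr_ge0 andbT -A0 sqr_entry_le.
Qed.

Lemma mdot_gt0 m n (A : 'M[R]_(m, n)) : A != 0 -> 0 < mdot A A.
Proof.
move=> A0; rewrite lt_neqAle mdot_ge0 andbT; apply: contra A0 => /eqP.
by move/esym/mdot_eq0 ->.
Qed.

Lemma mdot_young m n (A B : 'M[R]_(m, n)) (s : R) : 0 < s ->
  2 * mdot A B <= s * mdot A A + s^-1 * mdot B B.
Proof.
move=> s0; have := mdot_ge0 (s *: A - B).
have -> : mdot (s *: A - B) (s *: A - B)
    = s * (s * mdot A A + s^-1 * mdot B B - 2 * mdot A B).
  by rewrite !mdot_lin (mdotC B A); field; lra.
by rewrite pmulr_rge0// subr_ge0.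
Qed.

Lemma enormE n (u : 'rV[R]_n) : enorm u ^+ 2 = mdot u u.
Proof. by rewrite sqr_sqrtr dotpE// mdot_ge0. Qed.

Lemma enorm_ge0 n (u : 'rV[R]_n) : 0 <= enorm u.
Proof. exact: sqrtr_ge0. Qed.

Lemma enorm_le n (u v : 'rV[R]_n) : (enorm u <= enorm v) = (mdot u u <= mdot v v).
Proof. by rewrite ler_sqrt !dotpE // mdot_ge0. Qed.

(** The library topology is that of the max norm; this bound turns smallness or boundedness of
    [mdot] into the corresponding topological statement. *)
Lemma mdot_norm_le m n (A : 'M[R]_(m, n)) : `|A| ^+ 2 <= mdot A A.
Proof.
rewrite [`|A|]mx_normrE.
apply: (big_ind (fun x => x ^+ 2 <= mdot A A)).
- by rewrite expr0n mdot_ge0.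
- by move=> x y; case: (leP x y).
- by move=> i _; rewrite real_normK ?num_real// sqr_entry_le.
Qed.

End Frobenius.

Lemma sqr_lt_norm (R : realType) (a e : R) : 0 < e -> a ^+ 2 < e ^+ 2 -> `|a| < e.
Proof.
by move=> e0; rewrite -(real_normK (num_real a)) ltr_sqr ?nnegrE// ltW.
Qed.

(** * Cluster points of bounded matrix-valued maps *)

Section ClusterPoints.
Context {R : realType}.

Lemma cvg_coord T (F : set_system T) {FF : Filter F} m n
    (u : T -> 'M[R]_(m, n)) (a : 'M[R]_(m, n)) i j :
  u t @[t --> F] --> a -> u t i j @[t --> F] --> a i j.
Proof.
move=> ua.
exact: (@cvg_comp _ _ _ u (fun M : 'M[R]_(m, n) => M i j) _ _ _ ua
  (@coord_continuous _ _ _ i j a)).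
Qed.

Lemma cvg_mdot T (F : set_system T) {FF : Filter F} m n
    (u v : T -> 'M[R]_(m, n)) (a b : 'M[R]_(m, n)) :
  u t @[t --> F] --> a -> v t @[t --> F] --> b ->
  mdot (u t) (v t) @[t --> F] --> mdot a b.
Proof.
move=> ua vb; under eq_fun do rewrite mdotE.
rewrite mdotE; apply: cvg_big => [|i _]; first exact: add_continuous.
apply: cvg_big => [|j _]; first exact: add_continuous.
by apply: cvgM; exact: cvg_coord.
Qed.

Lemma cvg_mx_mdot T (F : set_system T) {FF : Filter F} m n
    (u : T -> 'M[R]_(m, n)) (a : 'M[R]_(m, n)) :
  mdot (u t - a) (u t - a) @[t --> F] --> (0 : R) -> u t @[t --> F] --> a.
Proof.
move=> /cvgrPdist_lt ua; apply/cvgrPdist_lt => e e0.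
have := ua (e ^+ 2) (exprn_gt0 _ e0); apply: filterS => t.
rewrite sub0r normrN ger0_norm ?mdot_ge0// => ute.
rewrite distrC -(ltr_sqr (x := `|_|)) ?nnegrE// ?(ltW e0)//.
by apply: le_lt_trans ute; exact: mdot_norm_le.
Qed.

Lemma cvg_mx_coord T (F : set_system T) {FF : Filter F} m n
    (u : T -> 'M[R]_(m, n)) (a : 'M[R]_(m, n)) :
  (forall i j, u t i j @[t --> F] --> a i j) -> u t @[t --> F] --> a.
Proof.
move=> ua; apply/cvgrPdist_le => /= e e0.
near=> t.
rewrite [leLHS]/Num.Def.normr/= mx_normrE (bigmax_le _ (ltW e0))//= => i _.
rewrite !mxE; move: i; near: t; apply: filter_forall => /= i.
exact: ((cvgrPdist_le _ _).1 (ua i.1 i.2)).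
Unshelve. all: by end_near. Qed.

Lemma cvg_mulmx T (F : set_system T) {FF : Filter F} m n p
    (u : T -> 'M[R]_(m, n)) (a : 'M[R]_(m, n)) (M : 'M[R]_(n, p)) :
  u t @[t --> F] --> a -> u t *m M @[t --> F] --> a *m M.
Proof.
move=> ua; apply: cvg_mx_coord => i j; under eq_fun do rewrite mxE.
rewrite mxE; apply: cvg_big => [|k _]; first exact: add_continuous.
by apply: cvgM; [exact: cvg_coord|exact: cvg_cst].
Qed.

(** Compactness of closed balls, transported from row vectors by [mxvec], an isometry for [mdot]. An
    arbitrary proper filter covers sequences, times tending to [+oo], steps tending to 0 from the
    right, and nested sublevel sets. *)
Lemma bounded_mx_cluster T (F : set_system T) {FF : ProperFilter F} m n
    (u : T -> 'M[R]_(m, n)) (B : R) :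
  (\forall t \near F, mdot (u t) (u t) <= B) ->
  exists l : 'M[R]_(m, n), forall e : R, 0 < e -> forall A, F A ->
    exists2 t, A t & mdot (u t - l) (u t - l) < e.
Proof.
move=> FB.
pose K := [set v : 'rV[R]_(m * n) | mdot v v <= B].
have cdot : continuous (fun v : 'rV[R]_(m * n) => mdot v v).
  by move=> v; apply: (@cvg_mdot _ (nbhs v) _ _ _ id id v v); exact: cvg_id.
have cK : compact K.
  apply: bounded_closed_compact.
    exists (B + 1); split; first exact: num_real.
    move=> x Bx v /= Kv; have := mdot_norm_le v => v2.
    rewrite leNgt; apply/negP => xv.
    have := le_trans v2 Kv; have := normr_ge0 v; nra.
  apply: (@preimage_closed _ _ (fun v : 'rV[R]_(m * n) => mdot v v) [set y | y <= B]).
    by move=> v _; exact: cdot.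
  exact: closed_le.
have vecD (a b : 'M[R]_(m, n)) : mdot (mxvec a) (mxvec b) = mdot a b.
  rewrite !mdotE big_ord1 pair_bigA/= (reindex _ (curry_mxvec_bij m n))/=.
  by apply: eq_bigr => -[i j] _; rewrite !mxvecE.
have FK : ((mxvec \o u) @ F) K.
  by rewrite /fmap/=; apply: filterS FB => t /=; rewrite /K/= vecD.
have [l [Kl ll]] := cK _ (fmap_proper_filter _ FF) FK.
exists (vec_mx l) => e e0 A FA.
have /(_ [set mxvec (u t) | t in A] [set v | mdot (v - l) (v - l) < e]) := ll.
case.
- by rewrite /fmap/=; apply: filterS FA => t At; exists t.
- have cl : v - l @[v --> (l : 'rV[R]_(m * n))] --> l - l.
    apply: (@cvgB _ _ _ (nbhs l) _ id (cst l)); [exact: cvg_id|exact: cvg_cst].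
  have : mdot (v - l) (v - l) @[v --> (l : 'rV[R]_(m * n))] --> (0 : R).
    have := cvg_mdot cl cl; rewrite subrr mdot0l; exact.
  move/cvgrPdist_lt => /(_ e e0); apply: filterS => v/=.
  by rewrite sub0r normrN ger0_norm// mdot_ge0.
- move=> _ [[t At <-] /= lt_e]; exists t => //.
  by rewrite -vecD linearB/= vec_mxK.
Qed.

End ClusterPoints.

(** * Second eigenvalue of a symmetric matrix *)

Section SymmetricGap.
Context {R : realType}.

Lemma sphere_compact n (A : set 'rV[R]_n) : closed A ->
  compact [set u : 'rV[R]_n | mdot u u = 1 /\ A u].
Proof.
move=> cA.
have cdot : continuous (fun v : 'rV[R]_n => mdot v v).
  by move=> v; apply: (@cvg_mdot _ _ (nbhs v) _ _ _ id id v v); exact: cvg_id.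
apply: bounded_closed_compact.
  exists 2; split; first exact: num_real.
  move=> x x2 v /= [v1 _]; have := mdot_norm_le v; rewrite v1 => v2.
  rewrite leNgt; apply/negP => xv; have := normr_ge0 v; nra.
apply: closedI => //.
apply: (@preimage_closed _ _ (fun v : 'rV[R]_n => mdot v v) [set 1]).
  by move=> v _; exact: cdot.
exact: closed_eq.
Qed.

Context {m : nat}.
Variable S : 'M[R]_(1 + m).
Local Notation one := (const_mx 1 : 'rV[R]_(1 + m)).
Hypotheses (m_gt0 : (0 < m)%N) (symS : S^T = S) (S1 : one *m S = 0).
Hypothesis psd : forall u : 'rV_(1 + m), 0 <= mdot (u *m S) u.
Hypothesis ker : forall u : 'rV_(1 + m), mdot (u *m S) u = 0 ->
  exists c, u = c *: one.

Let mdotS (u v : 'rV_(1 + m)) : mdot (u *m S) v = mdot u (v *m S).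
Proof. by rewrite -mdot_tr trmx_mul symS mdotMl symS -{1}symS -trmx_mul mdot_tr. Qed.

(** The minimum [a] of the Rayleigh quotient over the unit sphere of the hyperplane orthogonal to
    [one] is attained by compactness. At a minimizer [u] the residual [u *m S - a *: u] is
    orthogonal to that hyperplane; symmetry and [S1] put the residual itself in the hyperplane, so
    it vanishes. *)
Lemma orthogonal_eigenvalue : exists a : R,
  [/\ 0 < a, eigenvalue S a &
    forall u, mdot u one = 0 -> a * mdot u u <= mdot (u *m S) u].
Proof.
pose K := [set u : 'rV[R]_(1 + m) | mdot u u = 1 /\ mdot u one = 0].
have cK : compact K.
  apply: sphere_compact.
  apply: (@preimage_closed _ _ (fun v : 'rV[R]_(1 + m) => mdot v one) [set 0]).
    move=> v _; apply: (@cvg_mdot _ _ (nbhs v) _ _ _ id (fun=> one) v one).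
      exact: cvg_id.
    exact: cvg_cst.
  exact: closed_eq.
have one0 u : u != 0 -> mdot u one = 0 -> K ((Num.sqrt (mdot u u))^-1 *: u).
  move=> u0 u1; have uu := mdot_gt0 u0; split; rewrite !mdot_lin.
    by rewrite mulrA -invfM -expr2 sqr_sqrtr ?ltW// mulVf// gt_eqF.
  by rewrite u1 mulr0.
have K0 : K !=set0.
  (* [m_gt0] provides a second coordinate: the difference of the first two basis vectors is nonzero
     and orthogonal to [one]. *)
  pose v : 'rV[R]_(1 + m) := delta_mx 0 ord0 - delta_mx 0 (rshift 1 (Ordinal m_gt0)).
  eexists; apply: (one0 v).
    apply/eqP => /rowP/(_ ord0); rewrite !mxE !eqxx/= subr0 => /eqP.
    by rewrite oner_eq0.
  have d1 i : mdot (delta_mx 0 i) one = 1.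
    rewrite mdotE big_ord1 (bigD1 i)//= big1 => [|j /negPf ji].
      by rewrite !mxE !eqxx addr0 mulr1.
    by rewrite !mxE ji andbF mul0r.
  by rewrite !mdot_lin !d1 subrr.
have cq : continuous (fun u : 'rV[R]_(1 + m) => mdot (u *m S) u).
  move=> v; apply: (@cvg_mdot _ _ (nbhs v) _ _ _ (fun u => u *m S) id); last exact: cvg_id.
  by apply: (@cvg_mulmx _ _ (nbhs v) _ _ _ _ id v S); exact: cvg_id.
have [u] := compact_EVT_min K0 cK (continuous_subspaceT cq).
rewrite inE => -[u1 uone] Kmin.
pose a := mdot (u *m S) u.
have u0 : u != 0 by apply: contra_eqN u1 => /eqP ->; rewrite mdot0l eq_sym oner_eq0.
have amin w : mdot w one = 0 -> a * mdot w w <= mdot (w *m S) w.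
  move=> w1; have [->|w0] := eqVneq w 0; first by rewrite mul0mx !mdot0l mulr0.
  have ww := mdot_gt0 w0.
  have /mem_set/Kmin := one0 w w0 w1; rewrite -scalemxAl !mdot_lin mulrA.
  by rewrite -invfM -expr2 sqr_sqrtr ?(ltW ww)// ler_pdivlMl// (mulrC (mdot w w)).
have crit w : mdot w one = 0 -> mdot (u *m S - a *: u) w = 0.
  move=> w1.
  (* This is [amin] at [u + s *: w]. A polynomial [2 c s + q s ^ 2] nonnegative for all [s] has
     [c = 0]; the test value used below is [- c / (q + 1)], whose denominator stays positive when
     [q = 0]. *)
  have quad (s : R) : 0 <= s * (2 * mdot (u *m S - a *: u) w) +
      s ^+ 2 * (mdot (w *m S) w - a * mdot w w).
    have : mdot (u + s *: w) one = 0 by rewrite !mdot_lin uone w1 mulr0 addr0.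
    move/amin; rewrite mulmxDl -scalemxAl !mdot_lin -/a u1.
    rewrite (mdotS w u) (mdotC w (u *m S)) (mdotC w u); lra.
  set c := mdot _ w in quad *; set q := mdot (w *m S) w - _ in quad.
  have q0 : 0 <= q by rewrite subr_ge0 amin.
  clearbody c q.
  apply/eqP; rewrite -sqrf_eq0 eq_le sqr_ge0 andbT leNgt; apply/negP => c0.
  have := quad (- c / (q + 1)).
  have -> : - c / (q + 1) * (2 * c) + (- c / (q + 1)) ^+ 2 * q
      = - (c ^+ 2 * ((q + 2) / (q + 1) ^+ 2)) by field; lra.
  rewrite oppr_ge0 leNgt => /negP; apply.
  by rewrite mulr_gt0// divr_gt0 ?exprn_gt0//; lra.
have res1 : mdot (u *m S - a *: u) one = 0.
  by rewrite !mdot_lin uone mdotS S1 mdot0r mulr0 subrr.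
have uS : u *m S = a *: u.
  by apply/eqP; rewrite -subr_eq0; apply/eqP/mdot_eq0/crit.
exists a; split => //; last by apply/eigenvalueP; exists u.
rewrite lt_neqAle psd andbT; apply/eqP => /esym a0.
have [c uc] := ker a0.
have : c * mdot one u = 0 by rewrite (mdotC one) uone mulr0.
by rewrite -mdotZl -uc u1 => /eqP; rewrite oner_eq0.
Qed.

(** [ordered_eigenvalues] counts multiplicities in the characteristic polynomial, so the
    one-dimensional kernel must be turned into algebraic simplicity. In a basis starting with [one]
    the matrix has a zero first row, which splits off one factor ['X]. A second factor would give a
    null vector [v] of the remaining block [D]; by symmetry it yields a kernel vector of [S], hence
    a multiple of [one], which forces [v = 0]. *)
Lemma char_poly_simple_zero : ~~ ('X ^+ 2 %| char_poly S).
Proof.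
(* The rows of [P] are [one] and the basis vectors other than the first; [Q] is its inverse. *)
pose P : 'M[R]_(1 + m) := block_mx 1%:M (const_mx 1) 0 1%:M.
pose Q : 'M[R]_(1 + m) := block_mx 1%:M (- const_mx 1) 0 1%:M.
have PQ : P *m Q = 1%:M.
  by rewrite mulmx_block !(mul1mx, mulmx1, mul0mx, mulmx0, addr0, add0r) addNr -scalar_mx_block.
have QP : Q *m P = 1%:M by exact: mulmx1C.
have oneP : (row_mx 1%:M 0 : 'rV[R]_(1 + m)) *m P = one.
  rewrite mul_row_block !mul1mx !mul0mx !addr0.
  by apply/rowP => i; rewrite !mxE; case: splitP => j _; rewrite !mxE// ord1.
pose M := P *m S *m Q.
have M0 : usubmx M = 0.
  rewrite -[usubmx M]mul1mx.
  have -> : (1%:M : 'M[R]_1) *m usubmx M = (row_mx 1%:M 0 : 'rV_(1 + m)) *m M.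
    by rewrite -[M in RHS]vsubmxK mul_row_col mul0mx addr0.
  by rewrite !mulmxA oneP S1 mul0mx.
pose C := dlsubmx M; pose D := drsubmx M.
have ME : M = block_mx 0 0 C D.
  by rewrite -[LHS]submxK /ulsubmx /ursubmx M0 !linear0.
have charM : char_poly S = char_poly M.
  rewrite /char_poly /char_poly_mx.
  pose phi (A : 'M[R]_(1 + m)) := map_mx (polyC : R -> {poly R}) A.
  have -> : 'X%:M - phi M = phi P *m ('X%:M - phi S) *m phi Q.
    rewrite mulmxBr mulmxBl /phi -!map_mxM/= scalar_mxC; congr (_ - _).
    by rewrite -mulmxA -map_mxM PQ map_mx1 mulmx1.
  by rewrite !det_mulmx mulrAC -det_mulmx /phi -map_mxM PQ map_mx1 det1 mul1r.
have charMD : char_poly M = 'X * char_poly D.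
  rewrite /char_poly /char_poly_mx ME map_block_mx !map_mx0 scalar_mx_block.
  by rewrite opp_block_mx add_block_mx !oppr0 !addr0 det_lblock det_scalar1.
rewrite charM charMD expr2 dvdp_mul2l ?polyX_eq0//.
apply/negP => /dvdpP[r rE].
have : root (char_poly D) 0 by rewrite /root rE hornerM hornerX mulr0.
rewrite -eigenvalue_root_char => /eigenvalueP[v]; rewrite scale0r => vD v0.
pose w : 'rV[R]_(1 + m) := row_mx 0 v *m P.
have wS : w *m S = (v *m C) 0 0 *: one.
  rewrite -oneP.
  have -> : w *m S = row_mx 0 v *m M *m P by rewrite /w -!mulmxA QP mulmx1.
  rewrite ME mul_row_block !mulmx0 vD !add0r scalemxAl; congr (_ *m _).
  by rewrite scale_row_mx scaler0 scalemx1; congr row_mx; exact: mx11_scalar.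
have c0 : (v *m C) 0 0 = 0.
  have one_gt0 : 0 < mdot one one.
    apply: mdot_gt0; apply/eqP => /rowP/(_ ord0); rewrite !mxE => /eqP.
    by rewrite oner_eq0.
  have : mdot (w *m S) one = 0 by rewrite mdotS S1 mdot0r.
  by rewrite wS mdotZl => /eqP; rewrite mulf_eq0 (gt_eqF one_gt0) orbF => /eqP.
have [|k wk] := ker (u := w); first by rewrite wS c0 scale0r mdot0l.
case/eqP: v0; have : w *m Q = k *: (row_mx 1%:M 0).
  by rewrite wk -scalemxAl -oneP -mulmxA PQ mulmx1.
rewrite /w -mulmxA PQ mulmx1 scale_row_mx scaler0 => /eq_row_mx[] _.
by [].
Qed.

(** Nonnegativity and [S1] make the entry of index 0 vanish, and simplicity of 0 makes the entry of
    index 1 positive. The constrained minimum [a] is a positive eigenvalue, so it is at least that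
    entry. *)
Lemma second_eigenvalue_gap (lam : seq R) : ordered_eigenvalues S lam ->
  0 < lam`_1 /\ forall u, mdot u one = 0 -> lam`_1 * mdot u u <= mdot (u *m S) u.
Proof.
move=> [slam cS].
have [a [a0 aeig amin]] := orthogonal_eigenvalue.
have one0 : one != 0.
  by apply/eqP => /rowP/(_ ord0); rewrite !mxE => /eqP; rewrite oner_eq0.
have eig_lam b : eigenvalue S b = (b \in lam).
  by rewrite eigenvalue_root_char cS root_prod_XsubC.
have zlam : 0 \in lam.
  by rewrite -eig_lam; apply/eigenvalueP; exists one; rewrite // S1 scale0r.
have alam : a \in lam by rewrite -eig_lam.
have lam_ge0 b : b \in lam -> 0 <= b.
  rewrite -eig_lam => /eigenvalueP[v vS v0].
  by have := psd v; rewrite vS mdotZl pmulr_lge0// mdot_gt0.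
have nX := char_poly_simple_zero.
case: lam slam cS zlam alam lam_ge0 {eig_lam} => [//|l0 [|l1 lam]] slam cS zlam alam lam_ge0.
  by move: zlam alam; rewrite !inE => /eqP <- /eqP aE; rewrite aE ltxx in a0.
have /= /andP[l01] := slam.
rewrite (path_sortedE le_trans) => /andP[/allP l1min _].
have l0E : l0 = 0.
  apply/eqP; rewrite eq_le lam_ge0 ?mem_head// andbT.
  move: zlam; rewrite !inE => /or3P[/eqP <-//|/eqP ->//|/l1min].
  exact: le_trans l01.
have l1_gt0 : 0 < l1.
  rewrite lt_neqAle lam_ge0 ?inE ?eqxx ?orbT// andbT; apply/eqP => l1E.
  case/negP: nX; rewrite cS l0E -l1E !big_cons subr0 mulrA -expr2.
  exact: dvdp_mulIl.
split=> // u u1; apply: le_trans (amin u u1); rewrite ler_wpM2r ?mdot_ge0//=.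
move: alam; rewrite !inE => /or3P[/eqP aE|/eqP ->//|/l1min//].
by rewrite aE l0E ltxx in a0.
Qed.

End SymmetricGap.

(** * Spectral norm as a bound on matrix products *)

Section SpectralNorm.
Context {R : realType}.

Lemma mdot_cauchy m n (A B : 'M[R]_(m, n)) :
  mdot A B ^+ 2 <= mdot A A * mdot B B.
Proof.
have [->|A0] := eqVneq A 0; first by rewrite !mdot0l expr0n mul0r.
have AA := mdot_gt0 A0.
have := mdot_ge0 (mdot A A *: B - mdot A B *: A); rewrite !mdot_lin (mdotC B A).
rewrite [X in 0 <= X](_ : _ = mdot A A * (mdot A A * mdot B B - mdot A B ^+ 2)).
  by rewrite pmulr_rge0// subr_ge0.
by ring.
Qed.

(** A crude Frobenius bound, there to show that the set whose supremum is [spectral_norm] is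
    bounded. *)
Lemma enorm_mulmx_le m n (A : 'M[R]_(m, n)) (v : 'rV[R]_n) :
  mdot (v *m A^T) (v *m A^T) <= mdot A A * mdot v v.
Proof.
rewrite mdotE big_ord1 (mdot_rows A) mulr_suml; apply: ler_sum => i _.
rewrite -expr2; have -> : (v *m A^T) 0 i = mdot (row i A) v.
  by rewrite mxE mdotE big_ord1; apply: eq_bigr => j _; rewrite !mxE mulrC.
exact: mdot_cauchy.
Qed.

Lemma col_mulmx m n p (A : 'M[R]_(m, n)) (X : 'M[R]_(n, p)) j :
  col j (A *m X) = A *m col j X.
Proof. by rewrite !colE mulmxA. Qed.

Lemma spectral_norm_mulmx m n p (A : 'M[R]_(m, n)) (X : 'M[R]_(n, p)) :
  mdot (A *m X) (A *m X) <= spectral_norm A ^+ 2 * mdot X X.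
Proof.
pose S := [set enorm (v *m A^T) | v in [set v : 'rV[R]_n | enorm v <= 1]].
have ubS : has_ubound S.
  exists (Num.sqrt (mdot A A)) => _ [v /= v1 <-].
  rewrite /enorm dotpE ler_wsqrtr//; apply: le_trans (enorm_mulmx_le A v) _.
  by rewrite -enormE ler_piMr ?mdot_ge0// expr_le1// enorm_ge0.
have S0 : 0 <= spectral_norm A.
  apply: (ub_le_sup ubS); exists 0.
    by rewrite /= /enorm dotpE mdot0l sqrtr0.
  by rewrite mul0mx /enorm dotpE mdot0l sqrtr0.
rewrite (mdot_cols (A *m X)) (mdot_cols X) mulr_sumr; apply: ler_sum => j _.
pose v := (col j X)^T.
have -> : mdot (col j (A *m X)) (col j (A *m X)) = mdot (v *m A^T) (v *m A^T).
  by rewrite -trmx_mul mdot_tr col_mulmx.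
have -> : mdot (col j X) (col j X) = mdot v v by rewrite mdot_tr.
have [->|v0] := eqVneq v 0; first by rewrite mul0mx !mdot0l mulr0.
have v_gt0 : 0 < enorm v by rewrite sqrtr_gt0 dotpE mdot_gt0.
have : enorm (((enorm v)^-1 *: v) *m A^T) <= spectral_norm A.
  apply: (ub_le_sup ubS); exists ((enorm v)^-1 *: v) => //=.
  rewrite -(expr_le1 (n := 2))// ?enorm_ge0// enormE !mdot_lin -enormE.
  by rewrite mulrA -invfM -expr2 mulVf// expf_neq0// gt_eqF.
move=> le_v; have : enorm (((enorm v)^-1 *: v) *m A^T) ^+ 2 <= spectral_norm A ^+ 2.
  by rewrite ler_sqr ?nnegrE ?enorm_ge0.
rewrite enormE -scalemxAl !mdot_lin mulrA.
by rewrite -invfM -expr2 ler_pdivrMl ?exprn_gt0// enormE mulrC.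
Qed.

End SpectralNorm.

(** * Laplacian of a balanced digraph *)

Section Centering.
Context {R : realType} {N n : nat}.
Implicit Types X Y : 'M[R]_(N, n).

(** This is [1 (x) nu] in Kronecker notation; [center] below is the projection [P] of the
    overview. *)
Definition rowcst (nu : 'rV[R]_n) : 'M[R]_(N, n) := \matrix_i nu.

Definition rowsum X : 'rV[R]_n := \sum_i row i X.

Definition center X : 'M[R]_(N, n) := X - rowcst (N%:R^-1 *: rowsum X).

Lemma row_rowcst nu i : row i (rowcst nu) = nu.
Proof. by rewrite rowK. Qed.

Lemma rowsumB X Y : rowsum (X - Y) = rowsum X - rowsum Y.
Proof. by rewrite /rowsum -sumrB; apply: eq_bigr => i _; rewrite linearB. Qed.

Lemma rowsumE X : rowsum X = const_mx 1 *m X.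
Proof.
apply/rowP => j; rewrite summxE mxE.
by apply: eq_bigr => i _; rewrite !mxE mul1r.
Qed.

Lemma mdot_rowcst nu X : mdot (rowcst nu) X = mdot nu (rowsum X).
Proof.
rewrite mdot_rows mdotC mdot_suml; apply: eq_bigr => i _.
by rewrite row_rowcst mdotC.
Qed.

Lemma rowsum_rowcst nu : rowsum (rowcst nu) = N%:R *: nu.
Proof.
rewrite /rowsum (eq_bigr (fun=> nu)) => [|i _]; last exact: row_rowcst.
by rewrite sumr_const card_ord scaler_nat.
Qed.

Hypothesis N0 : (0 < N)%N.

Lemma rowsum_center X : rowsum (center X) = 0.
Proof.
by rewrite rowsumB rowsum_rowcst scalerA divff ?scale1r ?subrr// pnatr_eq0 -lt0n.
Qed.

Lemma mdot_centerl X Y : rowsum Y = 0 -> mdot (center X) Y = mdot X Y.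
Proof. by move=> Y0; rewrite mdotDl mdotNl mdot_rowcst Y0 mdot0r subr0. Qed.

Lemma center_eq0 X : center X = 0 -> exists nu, X = rowcst nu.
Proof.
by move=> /eqP; rewrite subr_eq0 => /eqP ?; exists (N%:R^-1 *: rowsum X).
Qed.

End Centering.

Section Laplacian.
Context {R : realType} {N : nat}.
Variable G : wdigraph R N.
Hypothesis hbal : weight_balanced G.
Local Notation L := (laplacian G).

Lemma row_laplacian n (X : 'M[R]_(N, n)) i :
  row i (L *m X) = \sum_j adj G i j *: (row i X - row j X).
Proof.
apply/rowP => k; rewrite /laplacian mulmxBl mul_diag_mx summxE !mxE.
under [RHS]eq_bigr do rewrite !mxE mulrBr.
by rewrite sumrB mulr_suml.
Qed.

Lemma ones_laplacian : (const_mx 1 : 'rV[R]_N) *m L = 0.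
Proof.
apply/rowP => j; rewrite mulmxBr !mxE.
under eq_bigr do rewrite !mxE mul1r.
under [X in _ - X]eq_bigr do rewrite mxE mul1r.
rewrite -hbal; apply/eqP; rewrite subr_eq0; apply/eqP.
rewrite [LHS](bigD1 j)//= eqxx mulr1n.
rewrite [X in _ + X]big1 ?addr0// => i /negPf ->.
by rewrite mulr0n.
Qed.

Lemma rowsum_laplacian n (X : 'M[R]_(N, n)) : rowsum (L *m X) = 0.
Proof. by rewrite rowsumE mulmxA ones_laplacian mul0mx. Qed.

Lemma laplacian_rowcst n (nu : 'rV[R]_n) : L *m rowcst nu = 0.
Proof.
apply/row_matrixP => i; rewrite row_laplacian row0 big1// => j _.
by rewrite !row_rowcst subrr scaler0.
Qed.

Lemma laplacian_center n (X : 'M[R]_(N, n)) : L *m center X = L *m X.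
Proof. by rewrite mulmxBr laplacian_rowcst subr0. Qed.

(** Each term [2 <x_i - x_j, x_i>] equals [|x_i - x_j| ^ 2 + |x_i| ^ 2 - |x_j| ^ 2]; after weighting
    and summing, the last two parts cancel because in-weights and out-weights agree. *)
Lemma laplacian_quadratic n (X : 'M[R]_(N, n)) :
  2 * mdot (L *m X) X =
  \sum_i \sum_j adj G i j * mdot (row i X - row j X) (row i X - row j X).
Proof.
rewrite mdot_rows mulr_sumr.
have -> : \sum_i 2 * mdot (row i (L *m X)) (row i X) =
    \sum_i \sum_j (adj G i j * mdot (row i X - row j X) (row i X - row j X) +
      (adj G i j * mdot (row i X) (row i X) - adj G i j * mdot (row j X) (row j X))).
  apply: eq_bigr => i _; rewrite row_laplacian mdot_suml mulr_sumr.
  apply: eq_bigr => j _; rewrite !mdot_lin (mdotC (row j X) (row i X)); ring.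
under eq_bigr do rewrite big_split/=.
rewrite big_split/= -[RHS]addr0; congr (_ + _).
under eq_bigr do rewrite sumrB.
rewrite sumrB [X in _ - X]exchange_big/=; apply/eqP; rewrite subr_eq0; apply/eqP.
by apply: eq_bigr => i _; rewrite -!mulr_suml hbal.
Qed.

Lemma adj_ge0 i j : 0 <= adj G i j.
Proof.
by have [/(adj_gt0)/ltW|/(adj_eq0) ->] := boolP (edge G i j).
Qed.

Lemma laplacian_psd n (X : 'M[R]_(N, n)) : 0 <= mdot (L *m X) X.
Proof.
rewrite -(pmulr_rge0 _ (ltr0n R 2)) laplacian_quadratic.
apply: sumr_ge0 => i _; apply: sumr_ge0 => j _.
by rewrite mulr_ge0 ?adj_ge0 ?mdot_ge0.
Qed.

Hypothesis hconn : strongly_connected G.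

(** A vanishing sum of nonnegative terms gives equality across every edge, and strong connectivity
    propagates it along paths. *)
Lemma laplacian_ker n (X : 'M[R]_(N, n)) : mdot (L *m X) X = 0 ->
  forall i j, row i X = row j X.
Proof.
move=> X0 i j.
have Xe k l : edge G k l -> row k X = row l X.
  move=> kl; apply/eqP; rewrite -subr_eq0; apply/eqP/mdot_eq0.
  have /eqP := laplacian_quadratic X; rewrite X0 mulr0 eq_sym psumr_eq0 => [|a _]; last first.
    by apply: sumr_ge0 => b _; rewrite mulr_ge0 ?adj_ge0 ?mdot_ge0.
  move=> /allP/(_ k (mem_index_enum _)); rewrite psumr_eq0 => [|b _]; last first.
    by rewrite mulr_ge0 ?adj_ge0 ?mdot_ge0.
  move=> /allP/(_ l (mem_index_enum _)).
  by rewrite /= mulf_eq0 gt_eqF ?adj_gt0//= => /eqP.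
have /connectP[p] := hconn i j.
elim: p i => [|k p IH] i /=; first by move=> _ ->.
by move=> /andP[ik kp] jE; rewrite (Xe _ _ ik); exact: IH.
Qed.

End Laplacian.

(** [S] and the Laplacian have the same quadratic form, and the vector of ones is killed by the
    Laplacian (constant rows) and by its transpose (weight balance). The symmetric gap then applies
    to each column of [X]. *)
Lemma laplacian_gap (R : realType) N (G : wdigraph R N) (lam : seq R) :
  (2 <= N)%N -> weight_balanced G -> strongly_connected G ->
  ordered_eigenvalues (2^-1 *: (laplacian G + (laplacian G)^T)) lam ->
  (0 < lam`_1) /\ forall n (X : 'M[R]_(N, n)), rowsum X = 0 ->
    lam`_1 * mdot X X <= mdot (laplacian G *m X) X.
Proof.
case: N G => [//|m] G hN hbal hconn hlam.
set L := laplacian G in hlam *.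
set S := 2^-1 *: _ in hlam.
have quad (u : 'rV[R]_(1 + m)) : mdot (u *m S) u = mdot (L *m u^T) u^T.
  rewrite /S -scalemxAr mulmxDr mdotZl mdotDl.
  rewrite -[mdot (u *m L^T) u]mdot_tr trmx_mul trmxK.
  rewrite -[mdot (u *m L) u]mdot_tr trmx_mul (mdotMl L^T) trmxK (mdotC u^T).
  by field.
have [|||||lam_gt0 gap] := @second_eigenvalue_gap R m S _ _ _ _ _ lam hlam.
- by [].
- by rewrite /S linearZ/= linearD/= trmxK addrC.
- rewrite /S -scalemxAr mulmxDr ones_laplacian// add0r -[const_mx 1]trmxK.
  rewrite -trmx_mul trmx_const.
  have -> : const_mx 1 = rowcst (const_mx 1 : 'rV[R]_1) :> 'cV[R]_(1 + m).
    by apply/matrixP => i j; rewrite !mxE.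
  rewrite laplacian_rowcst.
  by rewrite trmx0 scaler0.
- by move=> u; rewrite quad laplacian_psd.
- move=> u; rewrite quad => /(laplacian_ker hbal hconn) h.
  exists (u 0 0); apply/rowP => j; rewrite !mxE mulr1.
  by have /rowP/(_ 0) := h j 0; rewrite !mxE.
split=> // n X X0; rewrite (mdot_cols X) (mdot_cols (L *m X)) mulr_sumr.
apply: ler_sum => j _.
have := gap (col j X)^T; rewrite quad trmxK !mdot_tr col_mulmx; apply.
rewrite -trmx_const mdot_tr mdotC -[const_mx 1]mulmx1 mdotMl trmx_const.
rewrite -col_mulmx -rowsumE X0 mdotE big1// => i _; rewrite big1// => k _.
by rewrite !mxE mulr0.
Qed.

(** * Subgradients of convex functions *)

Section HahnBanach.
Context {R : realType} {V : lmodType R}.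
Implicit Types (p q : V -> R) (a z : V).

Definition convexf p := forall x y t, 0 <= t -> t <= 1 ->
  p ((1 - t) *: x + t *: y) <= (1 - t) * p x + t * p y.

Lemma convexf_mid p x y : convexf p -> p (2^-1 *: (x + y)) <= 2^-1 * (p x + p y).
Proof.
move=> cp; have := cp x y 2^-1; rewrite (_ : 1 - 2^-1 = 2^-1 :> R); last by field.
by rewrite -scalerDr -mulrDr; apply; lra.
Qed.

(** Since 0 is a convex combination of [- t *: a] and [u *: a] and [0 <= p 0], every slope on the
    left of 0 is at most every slope on the right; [s] is the supremum of the left ones. *)
Lemma convexf_line_subgradient p a : convexf p -> 0 <= p 0 ->
  exists s, forall t : R, t * s <= p (t *: a).
Proof.
move=> cp p0.
pose A := [set x | exists2 t : R, 0 < t & x = - p (- t *: a) / t].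
have key t u : 0 < t -> 0 < u -> - p (- t *: a) / t <= p (u *: a) / u.
  move=> t0 u0; have tu : 0 < t + u by lra.
  have := cp (- t *: a) (u *: a) (t / (t + u)).
  rewrite !scalerA -scalerDl.
  have -> : (1 - t / (t + u)) * - t + t / (t + u) * u = 0 by field; lra.
  rewrite scale0r => /(_ _ _)/(le_trans p0) h.
  rewrite ler_pdivrMr// mulrAC ler_pdivlMr//.
  have /h{}h : 0 <= t / (t + u) by rewrite divr_ge0// ltW.
  have /h{}h : t / (t + u) <= 1 by rewrite ler_pdivrMr//; lra.
  have : 0 <= (t + u) * ((1 - t / (t + u)) * p (- t *: a) + t / (t + u) * p (u *: a)).
    by rewrite mulr_ge0// ltW.
  rewrite (_ : _ * (_ + _) = u * p (- t *: a) + t * p (u *: a)); first by lra.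
  by field; lra.
have A0 : A !=set0 by exists (- p (- 1 *: a) / 1); exists 1.
have supA : has_sup A.
  split=> //; exists (p (1 *: a) / 1) => _ [t t0 ->]; exact: key.
exists (sup A) => t; have [t0|t0|->] := ltgtP t 0.
- have /(ub_le_sup supA.2) : A (- p (t *: a) / - t).
    by exists (- t); rewrite ?opprK// oppr_gt0.
  by rewrite invrN mulrN mulNr opprK ler_ndivrMr// mulrC.
- rewrite mulrC -ler_pdivlMr//; apply: ge_sup => // _ [u u0 ->]; exact: key.
- by rewrite mul0r scale0r.
Qed.

(* [q] is the infimal convolution of [p] with the line through [a]; it keeps
   every direction in which [p] is already affine and becomes affine along [a]. *)
Lemma hahn_banach_step p a : convexf p -> 0 <= p 0 ->
  exists q s, [/\ convexf q, 0 <= q 0, forall z, q z <= p z,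
    forall z t, q (z + t *: a) = q z + t * s &
    forall b r, (forall z t, p (z + t *: b) = p z + t * r) ->
                (forall z t, q (z + t *: b) = q z + t * r)].
Proof.
move=> cp p0; have [s hs] := convexf_line_subgradient a cp p0.
pose A z := [set x | exists t : R, x = p (z + t *: a) - t * s].
(* The midpoint of [z + t *: a] and [- z] lies on the line through [a], where [hs] bounds [p] from
   below; so the infimum defining [q] is finite. *)
have lbA z : lbound (A z) (- p (- z)).
  move=> _ [t ->]; have := convexf_mid (z + t *: a) (- z) cp.
  rewrite addrAC subrr add0r scalerA => /(le_trans (hs _)); lra.
have infA z : has_inf (A z).
  by split; [exists (p (z + 0 *: a) - 0 * s); exists 0|exists (- p (- z))].
pose q z := inf (A z).
have q_le x t : q x <= p (x + t *: a) - t * s.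
  by apply: (ge_inf (infA x).2); exists t.
have le_q x y c :
    (forall t, exists t', p (x + t' *: a) - t' * s <= p (y + t *: a) - t * s + c) ->
  q x <= q y + c.
  move=> h; rewrite -lerBlDr; apply: lb_le_inf; first exact: (infA y).1.
  by move=> _ [t ->]; have [t' ht'] := h t; rewrite lerBlDr (le_trans (q_le x t')).
have eq_q x y c : (forall t, exists t',
      p (x + t' *: a) - t' * s = p (y + t *: a) - t * s + c) ->
    (forall t, exists t',
      p (y + t' *: a) - t' * s = p (x + t *: a) - t * s - c) ->
  q x = q y + c.
  move=> h1 h2; apply/eqP; rewrite eq_le le_q/=; last first.
    by move=> t; have [t' e] := h1 t; exists t'; rewrite e.
  by rewrite -lerBrDr le_q// => t; have [t' e] := h2 t; exists t'; rewrite e.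
exists q, s; split.
- move=> x y l l0 l1; apply/ler_addgt0Pr => e e0.
  have [_ [t ->] ht] := inf_adherent e0 (infA x).
  have [_ [u ->] hu] := inf_adherent e0 (infA y).
  rewrite -/(q x) -/(q y) in ht hu.
  have := q_le ((1 - l) *: x + l *: y) ((1 - l) * t + l * u).
  have := cp (x + t *: a) (y + u *: a) l l0 l1.
  have -> : (1 - l) *: (x + t *: a) + l *: (y + u *: a) =
      (1 - l) *: x + l *: y + ((1 - l) * t + l * u) *: a.
    by rewrite !scalerDr !scalerA (scalerDl a) addrACA.
  by nra.
- by apply: lb_le_inf (infA 0).1 _ => _ [t ->]; rewrite add0r subr_ge0.
- by move=> z; have := q_le z 0; rewrite scale0r addr0 mul0r subr0.
- move=> z t; apply: eq_q => u.
    exists (u - t); have -> : z + t *: a + (u - t) *: a = z + u *: a.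
      by rewrite -addrA -scalerDl; congr (_ + _ *: _); ring.
    ring.
  exists (u + t); have -> : z + t *: a + u *: a = z + (u + t) *: a.
    by rewrite -addrA -scalerDl; congr (_ + _ *: _); ring.
  ring.
- move=> b r hb z t; apply: eq_q => u; exists u.
    by rewrite (addrAC z) hb; ring.
  by rewrite (addrAC z) hb; ring.
Qed.

Lemma hahn_banach_seq p (l : seq V) : convexf p -> 0 <= p 0 ->
  exists q, [/\ convexf q, 0 <= q 0, forall z, q z <= p z &
    forall a, a \in l -> exists s, forall z t, q (z + t *: a) = q z + t * s].
Proof.
move=> cp p0; elim: l => [|b l [q [cq q0 qp ql]]]; first by exists p; split.
have [q' [s [cq' q'0 q'q q'b q'l]]] := hahn_banach_step b cq q0.
exists q'; split => // [z|a]; first exact: le_trans (q'q z) (qp z).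
by rewrite inE => /predU1P[->|/ql[r hr]]; [exists s|exists r; exact: q'l].
Qed.

End HahnBanach.

Section Subgradient.
Context {R : realType} {n : nat}.
Implicit Types (f : 'rV[R]_n -> R) (u v : 'rV[R]_n).

(** Once [q] is affine along every basis vector it is affine on the whole space; [g] is its linear
    part, and [0 <= q 0] absorbs the constant. *)
Lemma hahn_banach_dot (p : 'rV[R]_n -> R) : convexf p -> 0 <= p 0 ->
  exists g, forall z, mdot g z <= p z.
Proof.
move=> cp p0.
have [q [_ q0 qp ql]] :=
  hahn_banach_seq [seq delta_mx 0 i | i : 'I_n] cp p0.
have /choice[s hs] i : exists s, forall z t,
    q (z + t *: delta_mx 0 i) = q z + t * s.
  by apply: ql; apply: map_f; rewrite mem_enum.
exists (\row_i s i) => z; apply: le_trans (qp z).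
suff -> : q z = q 0 + mdot (\row_i s i) z by lra.
rewrite mdotE big_ord1 [in LHS](row_sum_delta z).
rewrite (eq_bigr (fun i => z 0 i * s i)); last first.
  by move=> i _; rewrite mxE mulrC.
elim/big_rec2: _ => [|i x y _ IH]; first by rewrite addr0.
by rewrite addrC hs IH; ring.
Qed.

Lemma convex_function_convexf f : convex_function setT f -> convexf f.
Proof.
move=> cf x y t t0 t1.
have t0' : 0 <= 1 - t by lra.
have t1' : 1 - t <= 1 by lra.
have := cf (Itv01 t0' t1') x y; rewrite !in_setT => /(_ isT isT).
by rewrite convRE /conv/= /unstable.onem subKr.
Qed.

Lemma convex_set_conv (A : set 'rV[R]_n) u v (t : R) : convex_set A ->
  0 <= t -> t <= 1 -> A u -> A v -> A ((1 - t) *: u + t *: v).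
Proof.
move=> cA t0 t1 Au Av.
have t0' : 0 <= 1 - t by lra.
have t1' : 1 - t <= 1 by lra.
have := cA u v (Itv01 t0' t1'); rewrite !inE => /(_ Au Av).
by rewrite /conv/= /unstable.onem subKr.
Qed.

(* Apply [hahn_banach_dot] to the infimal convolution
   [z |-> inf_(y in A) f (z + y) - f u - nu . (y - u)]. *)
Lemma constrained_subgradient f (A : set 'rV[R]_n) u nu :
  convexf f -> convex_set A -> A u ->
  (forall y, A y -> f u + mdot nu (y - u) <= f y) ->
  exists2 g, subdiff f u g & forall y, A y -> mdot (nu - g) (y - u) <= 0.
Proof.
move=> cf cA Au hu.
pose S z := [set x | exists2 y, A y & x = f (z + y) - f u - mdot nu (y - u)].
have lbS z : lbound (S z) (f u - f (u - z)).
  move=> _ [y Ay ->].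
  (* This point is also the midpoint of [u - z] and [z + y]; convexity of [f] there, together with
     [hu], bounds [f (z + y)] from below and makes the infimum finite. *)
  have Am : A (2^-1 *: (u + y)).
    have := convex_set_conv cA _ _ Au Ay (t := 2^-1).
    rewrite (_ : 1 - 2^-1 = 2^-1 :> R); last by field.
    by rewrite -scalerDr; apply; lra.
  have := hu _ Am; have := convexf_mid (u - z) (z + y) cf.
  rewrite addrA subrK.
  have -> : 2^-1 *: (u + y) - u = 2^-1 *: (y - u).
    by apply/matrixP => i j; rewrite !mxE; field.
  by rewrite !mdot_lin; lra.
have infS z : has_inf (S z).
  by split; [exists (f (z + u) - f u - mdot nu (u - u)); exists u|
             exists (f u - f (u - z))].
pose p z := inf (S z).
have p_le z y : A y -> p z <= f (z + y) - f u - mdot nu (y - u).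
  by move=> Ay; apply: (ge_inf (infS z).2); exists y.
have cp : convexf p.
  move=> x y l l0 l1; apply/ler_addgt0Pr => e e0.
  have [_ [v Av ->] hv] := inf_adherent e0 (infS x).
  have [_ [w Aw ->] hw] := inf_adherent e0 (infS y).
  rewrite -/(p x) -/(p y) in hv hw.
  have := p_le ((1 - l) *: x + l *: y) _ (convex_set_conv cA l0 l1 Av Aw).
  have := cf (x + v) (y + w) l l0 l1.
  have -> : (1 - l) *: (x + v) + l *: (y + w) =
      (1 - l) *: x + l *: y + ((1 - l) *: v + l *: w).
    by rewrite !scalerDr addrACA.
  move: hv hw; rewrite !mdot_lin; nra.
have p0 : 0 <= p 0.
  apply: lb_le_inf (infS 0).1 _ => _ [y Ay ->].
  by rewrite add0r; have := hu _ Ay; lra.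
(* Testing [g] at [v - u] with the competitor [u] gives the subgradient inequality; testing it at
   [u - y] with the competitor [y] gives the normal-cone inequality. *)
have [g hg] := hahn_banach_dot cp p0; exists g.
  move=> v; have := le_trans (hg (v - u)) (p_le (v - u) u Au).
  by rewrite dotpE subrK subrr mdot0r; lra.
move=> y Ay; have := le_trans (hg (u - y)) (p_le (u - y) y Ay).
by rewrite subrK !mdot_lin; lra.
Qed.

Lemma subgradient_exists f u : convexf f -> exists g, subdiff f u g.
Proof.
move=> cf.
have := @constrained_subgradient f [set u] u 0 cf _ erefl.
case=> [x y l||g]; last by exists g.
- rewrite !inE => -> ->; rewrite /conv/= -scalerDl.
  by rewrite /unstable.onem addrC subrK scale1r.
- by move=> _ ->; rewrite mdot0l addr0.
Qed.

(* Strong monotonicity between [a], [y] and their midpoint: the constant is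
   halved with respect to the optimal [w / 2]. *)
Lemma strongly_convex_growth f (A : set 'rV[R]_n) w a y g :
  convexf f -> convex_set A -> strongly_convex_on w A f ->
  A a -> A y -> subdiff f a g ->
  f a + mdot g (y - a) + w / 4 * mdot (y - a) (y - a) <= f y.
Proof.
move=> cf cA sf Aa Ay ga.
pose m := 2^-1 *: (a + y).
have Am : A m.
  have := convex_set_conv cA _ _ Aa Ay (t := 2^-1).
  rewrite (_ : 1 - 2^-1 = 2^-1 :> R); last by field.
  by rewrite -scalerDr; apply; lra.
have [h hm] := subgradient_exists m cf.
have ma : m - a = 2^-1 *: (y - a).
  by apply/matrixP => i j; rewrite !mxE; field.
have ym : y - m = 2^-1 *: (y - a).
  by apply/matrixP => i j; rewrite !mxE; field.
have := sf _ _ _ _ Am Aa hm ga; rewrite enormE dotpE ma.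
have := ga m; have := hm y; rewrite !dotpE ma ym !mdot_lin.
rewrite !(mdotC _ h) !(mdotC _ g) !(mdotC a y).
lra.
Qed.

End Subgradient.

(** * Absolutely continuous functions *)

Section MonotoneAC.
Context {R : realType}.
Local Notation mu := (@lebesgue_measure R).
Implicit Types (f : R -> R) (a b : R).

Let two_sided_slope_le f (t d e : R) : is_derive t 1 f d -> d <= 0 -> 0 < e ->
  exists2 h, 0 < h & forall s, `|s - t| < h ->
    (t <= s -> f s - f t <= e * (s - t)) /\ (s <= t -> f t - f s <= e * (t - s)).
Proof.
move=> [df dE] d0 e0.
have /cvgrPdist_lt/(_ e e0) : h^-1 *: ((f \o shift t) (h *: 1) - f t) @[h --> 0^'] --> d.
  by rewrite -dE; exact: df.
rewrite /prop_near1 /dnbhs /within/= => /nbhs_ballP[h /= h0 hh].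
exists h => // s sh.
have [->|st] := eqVneq s t; first by rewrite !subrr mulr0.
have := hh (s - t); rewrite /ball/= sub0r normrN subr_eq0 => /(_ sh st).
rewrite /= [_ *: 1]mulr1 subrK => /ltr_normlP[+ _].
rewrite opprB ltrBlDr => lt_e; have {lt_e} : (s - t)^-1 * (f s - f t) < e.
  by apply: lt_le_trans lt_e _; rewrite gerDl.
move=> lt_e; split=> [ts|ts].
- have st0 : 0 < s - t by rewrite subr_gt0 lt_neqAle eq_sym st.
  by move: lt_e; rewrite ltr_pdivrMl// mulrC => /ltW.
- have st0 : s - t < 0 by rewrite subr_lt0 lt_neqAle st.
  move: lt_e; rewrite ltr_ndivrMl//; nra.
Qed.

(* Any point of [a, b] is reached from [a] by finitely many steps, along each of
   which either [f] grows by at most [e] times the length, or the step lies in an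
   open set [U] of small measure covering the exceptional null set. *)
Lemma ac_nonincreasing f (df : R -> R) a b : a <= b -> abs_continuous_on a b f ->
  {ae mu, forall t, a <= t <= b -> is_derive t 1 f (df t) /\ df t <= 0} ->
  f b <= f a.
Proof.
move=> ab acf [A [mA A0' nA]]; have A0 : mu A = 0%E := A0'.
(* The part [e * (b - a)] pays for the steps of small slope, the last [e] for those inside [U],
   whose total length stays below the modulus [d] of absolute continuity. *)
suff main e : 0 < e -> f b - f a <= e * (b - a) + e.
  rewrite -subr_le0; apply/ler_addgt0Pr => e e0; rewrite add0r.
  have ba : 0 < b - a + 1 by lra.
  have := main _ (divr_gt0 e0 ba).
  by rewrite -[X in _ <= _ + X -> _]mulr1 -mulrDr divfK// gt_eqF.
move=> e0; have [d d0 acd] := acf e e0.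
have [U [oU AU Ud]] : exists U : set R, [/\ open U, A `<=` U & (mu (U `\` A) < d%:E)%E].
  by apply: lebesgue_regularity_outer => //; apply: (@le_lt_trans _ _ 0%E); rewrite ?ltry//; exact: (eq_ind_r (fun x => (x <= 0)%E) (lexx _) A0).
have mU : measurable U by exact: measurable_realfun.open_measurable.
have {Ud} Ud : (mu U < d%:E)%E.
  have : (mu (A `|` (U `\` A)) <= mu A + mu (U `\` A))%E.
    by apply: measureU2 => //; exact: measurableD.
  by rewrite setDUK// A0 add0e => /le_lt_trans; exact.
(* [s] records the steps made inside [U], the latest first; their total length is charged to the
   part of [U] left of [c], so it never exceeds the measure of [U]. *)
pose reach c := a <= c <= b /\ exists s : seq (R * R),
  [/\ all (fun p => [&& a <= p.1, p.1 <= p.2 & p.2 <= c]) s,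
      pairwise (fun p q => q.2 <= p.1) s,
      ((\sum_(p <- s) (p.2 - p.1))%:E <= mu (U `&` `]-oo, c[))%E &
      f c - f a <= e * (c - a) + \sum_(p <- s) `|f p.2 - f p.1|].
have good c c' : reach c -> c <= c' <= b -> f c' - f c <= e * (c' - c) -> reach c'.
  move=> [/andP[ac cb] [s [sall spair smu sf]]] /andP[cc' c'b] fc; split.
    by rewrite (le_trans ac cc').
  exists s; split => //; last lra.
    apply: sub_all sall => p /and3P[-> -> /= pc]; exact: le_trans cc'.
  apply: le_trans smu _; apply: le_measure; rewrite ?inE.
  - by apply: measurableI => //; exact: measurable_itv.
  - by apply: measurableI => //; exact: measurable_itv.
  - by apply: setIS; apply: subset_itvl; rewrite bnd_simp.
have bad c c' : reach c -> c <= c' <= b -> `]c, c'[ `<=` U -> reach c'.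
  move=> [/andP[ac cb] [s [sall spair smu sf]]] /andP[cc' c'b] cU; split.
    by rewrite (le_trans ac cc').
  exists ((c, c') :: s); split.
  - rewrite /= ac cc' lexx/=.
    by apply: sub_all sall => p /and3P[-> -> /= pc]; exact: le_trans cc'.
  - rewrite /= spair andbT; apply: sub_all sall => p /and3P[_ _ //].
  - rewrite big_cons/= EFinD.
    have -> : (c' - c)%:E = mu `]c, c'[.
      rewrite lebesgue_measure_itv/= lte_fin; case: ltP => // c'c.
      by rewrite (le_anti (_ : c <= c' <= c)) ?subrr// cc'.
    apply: (@le_trans _ _ (mu (`]c, c'[ `|` (U `&` `]-oo, c[)))).
      have -> : mu (`]c, c'[ `|` (U `&` `]-oo, c[)) =
          (mu `]c, c'[ + mu (U `&` `]-oo, c[))%E; last by rewrite leeD2l.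
      apply: measureU => //; first by apply: measurableI => //; exact: measurable_itv.
      apply/seteqP; split=> // x /= []; rewrite !in_itv/= => /andP[cx _] [_].
      by rewrite ltNge (ltW cx).
    apply: le_measure; rewrite ?inE.
    + apply: measurableU => //; apply: measurableI => //; exact: measurable_itv.
    + by apply: measurableI => //; exact: measurable_itv.
    + move=> x /= [xc|[Ux]]; first by split; [exact: cU|move: xc; rewrite /= !in_itv/= => /andP[]].
      by rewrite /= !in_itv/= => xc; split=> //; exact: lt_le_trans cc'.
  - rewrite big_cons/=; have := ler_norm (f c' - f c); have := mulr_ge0 (ltW e0) (_ : 0 <= c' - c).
    rewrite subr_ge0 => /(_ cc'); lra.
(* Local form for a real induction: near [t], reachability passes from the left up to [t], and from
   [t] to the right. At the supremum of the reachable points the first half shows that it is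
   reached, the second that it is [b]. *)
have loc t : a <= t <= b -> exists2 h, 0 < h & forall u v, a <= u -> t - h < u -> u <= t ->
    t <= v -> v < t + h -> v <= b -> (reach u -> reach t) /\ (reach t -> reach v).
  move=> tab; move/andP: (tab) => [at_ tb]; have [At|nAt] := pselect (A t).
    have /nbhs_ballP[h /= h0 hU] : nbhs t U by apply: open_nbhs_nbhs; split=> //; exact: AU.
    exists h => // u v au hu ut tv vh vb; split=> [/bad|/bad]; apply; rewrite ?tb ?vb ?ut ?tv//.
      move=> x; rewrite /= in_itv/= => /andP[ux xt]; apply: hU; rewrite /ball/= ltr_norml; lra.
    move=> x; rewrite /= in_itv/= => /andP[ux xt]; apply: hU; rewrite /ball/= ltr_norml; lra.
  have [dt dt0] : is_derive t 1 f (df t) /\ df t <= 0.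
    by apply: contrapT => h; apply: nAt; apply: nA => /(_ tab).
  have [h h0 hh] := two_sided_slope_le dt dt0 e0.
  exists h => // u v au hu ut tv vh vb.
  have uh : `|u - t| < h by rewrite ltr_norml; lra.
  have vh' : `|v - t| < h by rewrite ltr_norml; lra.
  split=> [/good|/good]; apply; rewrite ?tb ?vb ?ut ?tv//.
    exact: (hh u uh).2.
  exact: (hh v vh').1.
have ra : reach a.
  split; first by rewrite lexx.
  by exists [::]; split => //; rewrite !big_nil ?measure_ge0// !subrr mulr0 addr0.
have supr : has_sup [set c | reach c].
  by split; [exists a|exists b => c [/andP[]]].
set c := sup [set c | reach c].
have ac : a <= c by exact: (ub_le_sup supr.2).
have cb : c <= b by apply: ge_sup => [|x [/andP[]]//]; exists a.
have [h h0 hh] := loc c (introT andP (conj ac cb)).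
have rc : reach c.
  have [u ru uc] := sup_adherent h0 supr.
  have [/andP[au _] _] := ru.
  have uc' : u <= c by exact: (ub_le_sup supr.2).
  have [] := hh u c au uc uc' (lexx _) _ cb; first by rewrite ltrDl.
  by move=> /(_ ru).
have rb : reach b.
  have [->|nbc] := eqVneq b c; first exact: rc.
  have cb' : c < b by rewrite lt_neqAle eq_sym nbc.
  pose v := Num.min b (c + h / 2).
  have cv : c < v by rewrite lt_min cb'/=; lra.
  have vb : v <= b by rewrite ge_min lexx.
  have vh : v < c + h by rewrite gt_min; apply/orP; right; lra.
  have [|_ /(_ rc) rv] := hh c v ac _ (lexx _) (ltW cv) vh vb; first lra.
  by have := ub_le_sup supr.2 rv; rewrite -/c leNgt cv.
have [_ [s [sall spair smu sf]]] := rb.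
apply: le_trans sf _; rewrite lerD2l; apply: ltW.
rewrite (big_nth (0, 0)) big_mkord.
apply: (acd _ (fun i => (nth (0, 0) s i).1) (fun i => (nth (0, 0) s i).2)).
- by move=> i; have /and3P[] := all_nthP (0, 0) sall i (ltn_ord i).
- apply/trivIsetP => i j _ _ ij.
  wlog lt_ij : i j ij / (i < j)%N.
    move=> H; have [/H|/H|/val_inj ji] := ltngtP i j; first exact.
      by rewrite setIC; apply; rewrite eq_sym.
    by rewrite ji eqxx in ij.
  have := pairwiseP (0, 0) spair i j (ltn_ord i) (ltn_ord j) lt_ij.
  move=> ji; apply/seteqP; split=> // x /= []; rewrite !in_itv/= => /andP[ix _] /andP[_ xj].
  by have := lt_trans ix (lt_le_trans xj ji); rewrite ltxx.
- rewrite -lte_fin; apply: le_lt_trans Ud.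
  apply: (@le_trans _ _ (mu (U `&` `]-oo, b[))).
    by move: smu; rewrite (big_nth (0, 0)) big_mkord.
  apply: le_measure; rewrite ?inE//; apply: measurableI => //; exact: measurable_itv.
Qed.

End MonotoneAC.

(** * Calculus of absolutely continuous functions and Barbalat's lemma *)

Section AcCalculus.
Context {R : realType}.
Local Notation mu := (@lebesgue_measure R).
Implicit Types (f g h df dg dh V dV : R -> R).

Lemma ae_imply (P S : R -> Prop) : (forall t, P t -> S t) ->
  {ae mu, forall t, P t} -> {ae mu, forall t, S t}.
Proof. by move=> h; apply: (@filterS _ _ (ae_filter_ringOfSetsType mu)) => t; exact: h. Qed.

Lemma ae_imply2 (P Q S : R -> Prop) : (forall t, P t -> Q t -> S t) ->
  {ae mu, forall t, P t} -> {ae mu, forall t, Q t} -> {ae mu, forall t, S t}.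
Proof. by move=> h; apply: (@filterS2 _ _ (ae_filter_ringOfSetsType mu)) => t; exact: h. Qed.

(** One comparison for all closure properties: [K = 1] for sums and matrix entries, [K = B + C] for
    products of factors bounded by [B] and [C], [K = 0] for constants. *)
Lemma abs_continuous_on_le (V W1 W2 : normedModType R) (a b K : R)
    (f : R -> W1) (g : R -> W2) (h : R -> V) :
  (forall u v, a <= u -> u <= v -> v <= b ->
    `|h v - h u| <= K * (`|f v - f u| + `|g v - g u|)) ->
  abs_continuous_on a b f -> abs_continuous_on a b g -> abs_continuous_on a b h.
Proof.
move=> hfg acf acg e e0.
have K0 : 0 < `|K| + 1 by rewrite ltr_wpDl.
have eK0 : 0 < e / (`|K| + 1) / 2 by rewrite !divr_gt0.
have [d1 d10 hd1] := acf _ eK0; have [d2 d20 hd2] := acg _ eK0.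
exists (Num.min d1 d2); first by rewrite lt_min d10.
move=> k u v uv tuv; rewrite lt_min => /andP[/(hd1 _ _ _ uv tuv) l1 /(hd2 _ _ _ uv tuv) l2].
apply: (@le_lt_trans _ _ ((`|K| + 1) *
    (\sum_(i < k) `|f (v i) - f (u i)| + \sum_(i < k) `|g (v i) - g (u i)|))).
  rewrite -big_split/= mulr_sumr; apply: ler_sum => i _.
  have [au [uv' vb]] := uv i.
  apply: le_trans (hfg _ _ au uv' vb) _; rewrite ler_wpM2r ?addr_ge0//.
  by have := ler_norm K; lra.
rewrite -[ltRHS](divfK (lt0r_neq0 K0)) mulrC ltr_pM2r//.
by rewrite [ltRHS]splitr ltrD.
Qed.

Lemma abs_continuous_on_id a b : abs_continuous_on a b (id : R -> R).
Proof.
move=> e e0; exists e => // k u v uv _ /(le_lt_trans _); apply; apply: ler_sum => i _.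
by have [_ [uvi _]] := uv i; rewrite ger0_norm ?subr_ge0.
Qed.

Lemma abs_continuous_on_within a b (V : normedModType R) (f : R -> V) :
  abs_continuous_on a b f -> {within `[a, b], continuous f}.
Proof.
move=> acf; apply/subspace_continuousP => x /=; rewrite in_itv/= => /andP[ax xb].
apply/cvgrPdist_lt => e e0; have [d d0 hd] := acf e e0.
rewrite near_withinE; near=> y => /=; rewrite in_itv/= => /andP[ay yb].
have yd : `|y - x| < d.
  by rewrite distrC; near: y; exact: cvgr_dist_lt.
have [xy|yx] := leP x y.
  have := hd 1%N (fun=> x) (fun=> y); rewrite !big_ord1 distrC; apply => //.
    by move=> i j _ _; rewrite !ord1.
  by move: yd; rewrite ltr_norml => /andP[].
have := hd 1%N (fun=> y) (fun=> x); rewrite !big_ord1; apply => //.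
- by move=> _; rewrite ay xb ltW.
- by move=> i j _ _; rewrite !ord1.
by move: yd; rewrite ltr_norml => /andP[+ _]; rewrite ltrNl opprB.
Unshelve. all: by end_near. Qed.

Lemma abs_continuous_on_bounded a b f : a <= b -> abs_continuous_on a b f ->
  exists2 B, 0 <= B & forall t, a <= t -> t <= b -> `|f t| <= B.
Proof.
move=> ab /abs_continuous_on_within cf.
have [c _ hc] := EVT_max ab cf; have [e _ he] := EVT_min ab cf.
exists (`|f c| + `|f e|) => [|t at_ tb]; first by rewrite addr_ge0.
have tab : t \in `[a, b] by rewrite in_itv/= at_ tb.
have := hc _ tab; have := he _ tab; have := ler_norm (f c); have := ler_norm (- f e).
by rewrite normrN ler_norml; have := normr_ge0 (f c); have := normr_ge0 (f e); lra.
Qed.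

(** The derivative is carried as a total function that is correct only almost everywhere on the
    half-line, so that explicit formulas for it compose under sums and products. *)
Definition ac_fun f df : Prop :=
  (forall T, 0 < T -> abs_continuous_on 0 T f) /\
  {ae mu, forall t : R, 0 <= t -> is_derive t 1 f (df t)}.

Lemma ac_fun_eq f df dg : (forall t, df t = dg t) -> ac_fun f df -> ac_fun f dg.
Proof. by move=> e; have -> : dg = df by apply/funext => t; rewrite e. Qed.

Lemma ac_fun_cst (c : R) : ac_fun (fun=> c) (fun=> 0).
Proof.
split=> [T _|]; last by apply: aeW => t _; exact: is_derive_cst.
apply: (@abs_continuous_on_le _ _ _ 0 T 0 id id) => [u v _ _ _||].
- by rewrite subrr normr0 mul0r.
- exact: abs_continuous_on_id.
- exact: abs_continuous_on_id.
Qed.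

Lemma ac_fun_id : ac_fun id (fun=> 1).
Proof.
by split=> [T _|]; [exact: abs_continuous_on_id|apply: aeW => t _; exact: is_derive_id].
Qed.

Lemma ac_funD f df g dg : ac_fun f df -> ac_fun g dg ->
  ac_fun (fun t => f t + g t) (fun t => df t + dg t).
Proof.
move=> [acf f'] [acg g']; split=> [T T0|].
  apply: (@abs_continuous_on_le _ _ _ 0 T 1 f g) => [u v _ _ _||]; [|exact: acf|exact: acg].
  by rewrite mul1r opprD addrACA ler_normD.
move: f' g'; apply: ae_imply2 => t f' g' t0.
by apply: is_deriveD; [exact: f'|exact: g'].
Qed.

Lemma ac_funM f df g dg : ac_fun f df -> ac_fun g dg ->
  ac_fun (fun t => f t * g t) (fun t => f t * dg t + g t * df t).
Proof.
move=> [acf f'] [acg g']; split=> [T T0|].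
  have [B B0 hB] := abs_continuous_on_bounded (ltW T0) (acf T T0).
  have [C C0 hC] := abs_continuous_on_bounded (ltW T0) (acg T T0).
  apply: (@abs_continuous_on_le _ _ _ 0 T (B + C) f g) => [u v u0 uv vT||];
    [|exact: acf|exact: acg].
  have -> : f v * g v - f u * g u = f v * (g v - g u) + g u * (f v - f u) by ring.
  apply: le_trans (ler_normD _ _) _; rewrite !normrM.
  have := hB v (le_trans u0 uv) vT; have := hC u u0 (le_trans uv vT).
  have := normr_ge0 (f v - f u); have := normr_ge0 (g v - g u).
  have := normr_ge0 (f v); have := normr_ge0 (g u); nra.
move: f' g'; apply: ae_imply2 => t f' g' t0.
by apply: is_deriveM; [exact: f'|exact: g'].
Qed.

Lemma ac_funZ (c : R) f df : ac_fun f df -> ac_fun (fun t => c * f t) (fun t => c * df t).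
Proof.
move=> acf; apply: ac_fun_eq (ac_funM (ac_fun_cst c) acf) => t.
by rewrite mulr0 addr0.
Qed.

Lemma ac_fun_sum (I : finType) (f df : I -> R -> R) :
  (forall i, ac_fun (f i) (df i)) ->
  ac_fun (fun t => \sum_i f i t) (fun t => \sum_i df i t).
Proof.
move=> acf; elim: (index_enum I) => [|i r IH].
  have e (g : I -> R -> R) : (fun t => \sum_(i <- [::]) g i t) = (fun=> 0).
    by apply/funext => t; rewrite big_nil.
  by rewrite !e; exact: ac_fun_cst.
have e (g : I -> R -> R) :
    (fun t => \sum_(j <- i :: r) g j t) = (fun t => g i t + \sum_(j <- r) g j t).
  by apply/funext => t; rewrite big_cons.
by rewrite !e; exact: ac_funD.
Qed.

Lemma ac_fun_le f df a b (C : R) : ac_fun f df -> 0 <= a -> a <= b ->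
  {ae mu, forall t, a <= t -> t <= b -> df t <= C} -> f b - f a <= C * (b - a).
Proof.
move=> acf a0 ab dfC.
have [acg g'] := ac_funD acf (ac_funZ (- C) ac_fun_id).
have := @ac_nonincreasing R (fun t => f t + - C * t) (fun t => df t + - C * 1) a b ab.
suff h : f b + - C * b <= f a + - C * a -> f b - f a <= C * (b - a).
  move=> /(_ _ _)/h; apply.
    (* [b] may be 0, while [ac_fun] gives absolute continuity on [[0, T]] for [0 < T]; hence the
       interval up to [b + 1]. *)
    have b0 : 0 < b + 1 by lra.
    move=> e e0; have [d d0 hd] := acg (b + 1) b0 e e0; exists d => // k u v uv.
    apply: hd => i; have [au [uvi vb]] := uv i.
    by split; [exact: le_trans au|split=> //; rewrite (le_trans vb)// lerDl].
  move: g' dfC; apply: ae_imply2 => t g' dfC /andP[at_ tb].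
  split; first by apply: g'; exact: le_trans at_.
  by have := dfC at_ tb; lra.
lra.
Qed.

(** If [h t] is at least [e], the upper bound on [dh] keeps [h] above [e / 2] on the preceding
    window of length [tau], so [V] drops by [delta * (e / 2) * tau] there. This is impossible once
    the window lies beyond a time [T] at which [V] is within that amount of its infimum. *)
Lemma barbalat V dV h dh (delta C : R) :
  0 < delta -> ac_fun V dV -> ac_fun h dh ->
  (forall t, 0 <= t -> 0 <= V t) -> (forall t, 0 <= t -> 0 <= h t) ->
  {ae mu, forall t, 0 <= t -> dV t <= - delta * h t} ->
  {ae mu, forall t, 0 <= t -> dh t <= C} ->
  forall e, 0 < e -> \forall t \near +oo, h t < e.
Proof.
move=> dl0 acV ach V0 h0 dVh dhC e e0.
have Vd s t : 0 <= s -> s <= t -> V t <= V s.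
  move=> s0 st; rewrite -subr_le0 -(mul0r (t - s)); apply: (ac_fun_le acV) => //.
  move: dVh; apply: ae_imply => u dVu su _; have u0 : 0 <= u by exact: le_trans su.
  by rewrite (le_trans (dVu u0))// mulNr oppr_le0 mulr_ge0 ?h0// ltW.
pose S := [set V t | t in [set t | 0 <= t]].
have infS : has_inf S.
  split; first by exists (V 0), 0 => //=.
  by exists 0 => _ [t /= t0 <-]; exact: V0.
pose K := `|C| + 1; have K0 : 0 < K by rewrite /K; have := normr_ge0 C; lra.
pose tau := e / (2 * K); have tau0 : 0 < tau by rewrite /tau divr_gt0// mulr_gt0.
have gap0 : 0 < delta * (e / 2) * tau.
  by apply: mulr_gt0 => //; apply: mulr_gt0 => //; rewrite divr_gt0.
have [_ [T /= T0 <-] VT] := inf_adherent gap0 infS.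
exists (T + tau); split=> [|t Tt]; first exact: num_real.
rewrite ltNge; apply/negP => et.
have t0 : 0 <= t - tau by lra.
have hs s : t - tau <= s -> s <= t -> e / 2 <= h s.
  move=> ts st; have := @ac_fun_le h dh s t K ach (le_trans t0 ts) st.
  have -> : K * (t - s) = e / 2 * ((t - s) / tau).
    by rewrite /tau; field; lra.
  move=> /(_ _)/wrap[].
    move: dhC; apply: ae_imply => u dhu su _; apply: le_trans (dhu (le_trans (le_trans t0 ts) su)) _.
    by rewrite /K; have := ler_norm C; lra.
  have : (t - s) / tau <= 1 by rewrite ler_pdivrMr//; lra.
  nra.
have tt : t - tau <= t by lra.
have := @ac_fun_le V dV (t - tau) t (- delta * (e / 2)) acV t0 tt.
move=> /(_ _)/wrap[].
  move: dVh; apply: ae_imply => u dVu tu ut; apply: le_trans (dVu (le_trans t0 tu)) _.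
  by rewrite !mulNr lerN2 ler_wpM2l ?(ltW dl0)// hs.
rewrite subKr.
have : inf S <= V t by apply: (ge_inf infS.2); exists t => //=; lra.
have : V (t - tau) <= V T by apply: Vd; lra.
lra.
Qed.

End AcCalculus.

Section AcCurve.
Context {R : realType} {m n : nat}.
Implicit Types A B dA dB : R -> 'M[R]_(m, n).

Definition ac_curve A dA : Prop :=
  forall i j, ac_fun (fun t => A t i j) (fun t => dA t i j).

Lemma ac_curve_of A : locally_abs_continuous A ->
  {ae @lebesgue_measure R, forall t, 0 <= t -> derivable A t 1} ->
  ac_curve A (A^`()%classic).
Proof.
move=> acA derA i j; split=> [T T0|].
  apply: (@abs_continuous_on_le _ _ _ _ 0 T 1 A A) => [u v _ _ _||]; [|exact: acA|exact: acA].
  rewrite mul1r; apply: (@le_trans _ _ `|A v - A u|); last by rewrite lerDl.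
  rewrite [leRHS]mx_normrE.
  by apply: le_trans (le_bigmax _ _ (i, j)); rewrite !mxE.
move: derA; apply: ae_imply => t dA t0; have {}dA := dA t0.
split; first by have /derivable_mxP := dA; exact.
by rewrite derive1E derive_mx// mxE.
Qed.

Lemma ac_curveD A dA B dB : ac_curve A dA -> ac_curve B dB ->
  ac_curve (fun t => A t + B t) (fun t => dA t + dB t).
Proof.
move=> acA acB i j; have := ac_funD (acA i j) (acB i j).
have e (X Y : R -> 'M[R]_(m, n)) :
    (fun t => (X t + Y t) i j) = (fun t => X t i j + Y t i j).
  by apply/funext => t; rewrite mxE.
by rewrite -!e.
Qed.

Lemma ac_curve_cst (c : 'M[R]_(m, n)) : ac_curve (fun=> c) (fun=> 0).
Proof. by move=> i j; apply: ac_fun_eq (ac_fun_cst _) => t; rewrite mxE. Qed.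

Lemma ac_curveB_cst A dA (c : 'M[R]_(m, n)) : ac_curve A dA ->
  ac_curve (fun t => A t - c) dA.
Proof.
move=> acA; have := ac_curveD acA (ac_curve_cst (- c)).
by have -> : (fun t => dA t + 0) = dA by apply/funext => t; rewrite addr0.
Qed.

Lemma ac_fun_mdot A dA B dB : ac_curve A dA -> ac_curve B dB ->
  ac_fun (fun t => mdot (A t) (B t)) (fun t => mdot (A t) (dB t) + mdot (dA t) (B t)).
Proof.
move=> acA acB.
have -> : (fun t => mdot (A t) (B t)) = (fun t => \sum_i \sum_j A t i j * B t i j).
  by apply/funext => t; rewrite mdotE.
apply: (@ac_fun_eq _ _ (fun t => \sum_i \sum_j (A t i j * dB t i j + B t i j * dA t i j))).
  move=> t; rewrite !mdotE -big_split/=; apply: eq_bigr => i _.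
  by rewrite -big_split/=; apply: eq_bigr => j _; rewrite (mulrC (dA t i j)).
by apply: ac_fun_sum => i; apply: ac_fun_sum => j; exact: ac_funM.
Qed.

End AcCurve.

Lemma ac_curve_mulmx (R : realType) m n p (M : 'M[R]_(p, m))
    (A dA : R -> 'M[R]_(m, n)) :
  ac_curve A dA -> ac_curve (fun t => M *m A t) (fun t => M *m dA t).
Proof.
move=> acA i j; have e (X : R -> 'M[R]_(m, n)) :
    (fun t => (M *m X t) i j) = (fun t => \sum_k M i k * X t k j).
  by apply/funext => t; rewrite mxE.
rewrite !e; apply: ac_fun_sum => k; exact: ac_funZ.
Qed.

Lemma ac_curve_row (R : realType) m n (A dA : R -> 'M[R]_(m, n)) i :
  ac_curve A dA -> ac_curve (fun t => row i (A t)) (fun t => row i (dA t)).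
Proof.
move=> acA k j; have e (X : R -> 'M[R]_(m, n)) :
    (fun t => row i (X t) k j) = (fun t => X t i j).
  by apply/funext => t; rewrite mxE.
by rewrite !e.
Qed.

(** * Projections *)

Section Minimizer.
Context {R : realType} {m n : nat}.
Implicit Types (A : set 'M[R]_(m, n)) (a y : 'M[R]_(m, n)).

Lemma nbhs_mdot a (U : set 'M[R]_(m, n)) : nbhs a U ->
  exists2 e : R, 0 < e & forall y, mdot (y - a) (y - a) < e -> U y.
Proof.
move=> /nbhs_ballP[e /= e0 eU]; exists (e ^+ 2) => [|y ye]; first exact: exprn_gt0.
apply: eU; rewrite -ball_normE/= distrC -(ltr_sqr (x := `|_|)) ?nnegrE// ?(ltW e0)//.
by apply: le_lt_trans ye; exact: mdot_norm_le.
Qed.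

Lemma closed_mdot A a : closed A ->
  (forall e : R, 0 < e -> exists2 y, A y & mdot (y - a) (y - a) < e) -> A a.
Proof.
move=> cA h; apply: cA => U /nbhs_mdot[e e0 eU].
by have [y Ay ye] := h e e0; exists y; split=> //; exact: eU.
Qed.

Lemma mdot_small H (e : R) : 0 < e -> exists2 d : R, 0 < d &
  forall y, mdot y y < d -> `|mdot H y| < e.
Proof.
move=> e0; have k0 : 0 < mdot H H + 1 by rewrite ltr_wpDl// mdot_ge0.
exists (e ^+ 2 / (mdot H H + 1)) => [|y].
  by rewrite divr_gt0// exprn_gt0.
rewrite ltr_pdivlMr// => ye; apply: sqr_lt_norm => //.
apply: le_lt_trans (mdot_cauchy H y) _; apply: le_lt_trans ye.
by rewrite mulrC ler_wpM2l ?mdot_ge0// lerDl.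
Qed.

(** Sublevel sets are nested, so they generate a proper filter, and coercivity gives it a cluster
    point [l]. The affine minorant of [F] at [l] plays the part of lower semicontinuity and yields
    [F l <= F y]. *)
Lemma subdiff_coercive_minimizer A (F : 'M[R]_(m, n) -> R) : closed A -> A !=set0 ->
  (forall a, A a -> exists H, forall y, A y -> F a + mdot H (y - a) <= F y) ->
  (forall K, exists B, forall y, A y -> F y <= K -> mdot y y <= B) ->
  exists2 a, A a & forall y, A y -> F a <= F y.
Proof.
move=> cA [a0 Aa0] sub coer.
pose B y0 := [set y | A y /\ F y <= F y0].
have BF : ProperFilter (filter_from A B).
  apply: filter_from_proper; last by move=> y Ay; exists y; split.
  apply: filter_from_filter; first by exists a0.
  move=> y z Ay Az; have [yz|zy] := leP (F y) (F z).
    by exists y => // w [Aw wy]; split; split=> //; exact: le_trans yz.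
  by exists z => // w [Aw wz]; split; split=> //; exact: le_trans (ltW zy).
have [K hK] := coer (F a0).
have [|l hl] := @bounded_mx_cluster R _ _ BF m n id K.
  by exists a0 => // y [Ay ya0]; exact: hK.
have Al : A l.
  apply: (@closed_mdot A l cA) => e e0.
  have [|y Ay ye] := hl e e0 A; last by exists y.
  by exists a0 => // y [].
exists l => // y Ay; apply/ler_addgt0Pr => e e0.
have [H hH] := sub l Al; have [d d0 hd] := mdot_small H e0.
have [|z [Az zy] zd] := hl d d0 (B y); first by exists y.
have := hH z Az; have := hd _ zd; rewrite ltr_norml => /andP[]; lra.
Qed.

End Minimizer.

Section Projection.
Context {R : realType} {n : nat}.
Variable A : set 'rV[R]_n.
Hypotheses (cA : closed A) (vA : convex_set A).
Implicit Types (u v w p : 'rV[R]_n).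

Lemma nearest_variational p v : A p ->
  (forall w, A w -> mdot (v - p) (v - p) <= mdot (v - w) (v - w)) ->
  forall w, A w -> mdot (v - p) (w - p) <= 0.
Proof.
move=> Ap hp w Aw; rewrite leNgt; apply/negP => c0.
set c := mdot (v - p) (w - p) in c0; set q := mdot (w - p) (w - p).
have q0 : 0 <= q := mdot_ge0 _.
(* This [t] satisfies [t <= 1] and [t * q <= c], so moving by [t] toward [w] changes the squared
   distance by [t * (t * q - 2 * c) < 0]. *)
pose t := c / (c + q).
have cq : 0 < c + q by lra.
have t0 : 0 < t by rewrite divr_gt0.
have t1 : t <= 1 by rewrite ler_pdivrMr//; lra.
have := hp _ (convex_set_conv vA (ltW t0) t1 Ap Aw).
have -> : v - ((1 - t) *: p + t *: w) = (v - p) - t *: (w - p).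
  by apply/matrixP => i j; rewrite !mxE; ring.
have tq : t * q <= c.
  by rewrite /t mulrAC ler_pdivrMr// ler_wpM2l ?ltW//; lra.
have -> : mdot (v - p - t *: (w - p)) (v - p - t *: (w - p)) =
    mdot (v - p) (v - p) + t * (t * q - 2 * c).
  by rewrite /c /q; move: (v - p) (w - p) => x y; rewrite !mdot_lin (mdotC y x); ring.
rewrite lerDl pmulr_rge0//; lra.
Qed.

(** Expanding the square around [p] shows that [p] is nearest and that any nearest point coincides
    with it; this uniqueness evaluates the [get] in [eproj]. *)
Lemma variational_eproj p v : A p ->
  (forall w, A w -> mdot (v - p) (w - p) <= 0) -> eproj A v = p.
Proof.
move=> Ap hp.
have dec w : mdot (v - w) (v - w) =
    mdot (v - p) (v - p) - 2 * mdot (v - p) (w - p) + mdot (w - p) (w - p).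
  have -> : v - w = (v - p) - (w - p) by rewrite opprB addrA subrK.
  by move: (v - p) (w - p) => x y; rewrite !mdot_lin (mdotC y x); ring.
apply: get_unique => [|y [Ay hy]].
  split=> // w Aw; rewrite enorm_le (dec w); have := hp w Aw; have := mdot_ge0 (w - p); lra.
apply/eqP; rewrite -subr_eq0; apply/eqP/mdot_eq0/eqP.
rewrite eq_le mdot_ge0 andbT; have := hy p Ap; rewrite enorm_le (dec y).
have := hp y Ay; lra.
Qed.

Lemma eproj_spec v : A !=set0 ->
  A (eproj A v) /\ forall w, A w -> mdot (v - eproj A v) (w - eproj A v) <= 0.
Proof.
move=> A0.
have [||a Aa amin] :=
    @subdiff_coercive_minimizer R 1 n A (fun y => mdot (v - y) (v - y)) cA A0.
- move=> a Aa; exists (- 2 *: (v - a)) => y Ay.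
  have -> : v - y = (v - a) - (y - a) by rewrite opprB addrA subrK.
  move: (v - a) (y - a) => x z; have := mdot_ge0 z.
  by rewrite !mdot_lin (mdotC z x); lra.
- move=> K; exists (2 * K + 2 * mdot v v) => y _ yK.
  have := mdot_ge0 (2 *: v - y); move: yK; rewrite !mdot_lin (mdotC y v); lra.
have hv := nearest_variational Aa amin.
by rewrite (variational_eproj Aa hv).
Qed.

(* [q e] is the projection of [v] onto the convex set [(A - u) / e], which
   grows as [e] decreases: the distances to [v] decrease, so [q] is Cauchy. *)
Lemma scaled_projection_cvg u v (q : R -> 'rV[R]_n) : A u ->
  (forall e, 0 < e -> A (u + e *: q e)) ->
  (forall e z, 0 < e -> A (u + e *: z) -> mdot (v - q e) (z - q e) <= 0) ->
  exists l : 'rV[R]_n, q @ 0^'+ --> l /\ forall w, A w -> mdot (v - l) (w - u) <= 0.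
Proof.
move=> Au Aq hq.
have Aseg e e' z : 0 < e -> e <= e' -> A (u + e' *: z) -> A (u + e *: z).
  move=> e0 ee' Az; have e'0 : 0 < e' by lra.
  have h0 : 0 <= e / e' by rewrite divr_ge0// ltW.
  have h1 : e / e' <= 1 by rewrite ler_pdivrMr// mul1r.
  have := convex_set_conv vA h0 h1 Au Az.
  by rewrite scalerDr addrA -scalerDl subrK scale1r scalerA divfK// gt_eqF.
pose g e := mdot (v - q e) (v - q e).
have gq e e' : 0 < e -> e <= e' -> g e + mdot (q e - q e') (q e - q e') <= g e'.
  move=> e0 ee'; have e'0 : 0 < e' by lra.
  have := hq e (q e') e0 (Aseg _ _ _ e0 ee' (Aq e' e'0)).
  rewrite /g; have -> : v - q e' = (v - q e) - (q e' - q e) by rewrite opprB addrA subrK.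
  have -> : q e - q e' = - (q e' - q e) by rewrite opprB.
  by move: (v - q e) (q e' - q e) => x y; rewrite !mdot_lin (mdotC y x); lra.
have cl : exists l : 'rV[R]_n, forall e : R, 0 < e -> exists2 d, 0 < d &
    forall s, 0 < s -> s <= d -> mdot (q s - l) (q s - l) < e.
  have [|l hl] := @bounded_mx_cluster R _ (0^'+ : set_system R) _ 1 n q
      (2 * (g 1 + mdot (q 1) (q 1))).
    near=> s.
    have s0 : 0 < s by [].
    have s1 : s <= 1 by near: s; exact: nbhs_right_le.
    have := gq s 1 s0 s1; have := mdot_ge0 (v - q s); rewrite -/(g s).
    have := mdot_ge0 (q s - 2 *: q 1); rewrite !mdot_lin (mdotC (q 1) (q s)); lra.
  exists l => e e0.
  pose S := [set g s | s in [set s | 0 < s]].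
  have infS : has_inf S.
    split; first by exists (g 1), 1 => //=.
    by exists 0 => _ [s _ <-]; exact: mdot_ge0.
  (* [q s - l] is split below into three vectors of squared length under [e / 10]; its square is at
     most three times their sum, hence under [e]. *)
  have e10 : 0 < e / 10 by lra.
  have [_ [d /= d0 <-] hd] := inf_adherent e10 infS.
  have cau s : 0 < s -> s <= d -> mdot (q s - q d) (q s - q d) < e / 10.
    move=> s0 sd; have := gq s d s0 sd.
    have : inf S <= g s by apply: (ge_inf infS.2); exists s.
    by lra.
  exists d => // s s0 sd.
  have [|r rd rl] := hl (e / 10) e10 [set r | 0 < r <= d].
    near=> r => /=; apply/andP; split=> //.
    by near: r; exact: nbhs_right_le.
  move/andP: rd => [r0 rd].
  have := cau s s0 sd; have := cau r r0 rd.
  have -> : q s - l = (q s - q d) - (q r - q d) + (q r - l).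
    by apply/rowP => j; rewrite !mxE; ring.
  move: (q s - q d) (q r - q d) (q r - l) rl => x y z rl yl xl.
  have := mdot_ge0 (x + y); have := mdot_ge0 (x - z); have := mdot_ge0 (y + z).
  rewrite !mdot_lin (mdotC y x) (mdotC z x) (mdotC z y); lra.
have {}cl : exists l : 'rV[R]_n, q @ 0^'+ --> l.
  have [l hl] := cl; exists l; apply: cvg_mx_mdot; apply/cvgrPdist_lt => e e0.
  have [d d0 hd] := hl e e0; near=> s.
  rewrite sub0r normrN ger0_norm ?mdot_ge0// hd//.
  by near: s; exact: nbhs_right_le.
have [l ql] := cl; exists l; split => // w Aw.
(* For small [e] the point [u + (e * s) *: (w - u)] lies on the segment from [u] to [w], so [hq] can
   be tested at [s *: (w - u)] and passed to the limit. Letting [s] be large then excludes a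
   positive product. *)
have lim_le (s : R) : 0 <= s -> s * mdot (v - l) (w - u) <= mdot (v - l) l.
  move=> s0; rewrite -mdotZr -subr_le0 -mdotNr -mdotDr.
  have : mdot (v - q e) (s *: (w - u) - q e) @[e --> 0^'+] --> mdot (v - l) (s *: (w - u) - l).
    have c (a : 'rV[R]_n) : a - q e @[e --> 0^'+] --> a - l.
      by apply: (@cvgB _ _ _ _ _ (fun=> a) q) => //; exact: cvg_cst.
    exact: cvg_mdot (c v) (c _).
  move=> hc; rewrite leNgt; apply/negP => pos.
  have := cvgr_gt _ hc _ pos => hn.
  have : \forall e \near (0 : R)^'+, False.
    near=> e.
    have e0 : 0 < e by [].
    have : 0 < mdot (v - q e) (s *: (w - u) - q e) by near: e; exact: hn.
    apply/negP; rewrite -leNgt; apply: hq => //.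
    rewrite scalerA -[X in A (X + _)]scale1r.
    have -> : 1 *: u + (e * s) *: (w - u) = (1 - e * s) *: u + (e * s) *: w.
      by apply/matrixP => i j; rewrite !mxE; ring.
    apply: convex_set_conv => //; first by rewrite mulr_ge0// ltW.
    have es : e <= (s + 1)^-1.
      by near: e; apply: nbhs_right_le; rewrite invr_gt0; lra.
    apply: le_trans (_ : (s + 1)^-1 * s <= 1); first by rewrite ler_wpM2r.
    by rewrite ler_pdivrMl; lra.
  by move=> /filter_ex[].
rewrite leNgt; apply/negP => c0.
have h : 0 <= (mdot (v - l) l ^+ 2 + 1) / mdot (v - l) (w - u).
  by rewrite divr_ge0 ?(ltW c0)// addr_ge0// sqr_ge0.
have := lim_le _ h; rewrite divfK ?gt_eqF//; nra.
Unshelve. all: by end_near. Qed.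

(** [dproj] is a [lim], which carries information only once convergence is known. *)
Lemma dproj_cvg u v : A u -> exists l : 'rV[R]_n,
  (fun e : R => e^-1 *: (eproj A (u + e *: v) - u)) @ 0^'+ --> l /\
  forall w, A w -> mdot (v - l) (w - u) <= 0.
Proof.
move=> Au; have A0 : A !=set0 by exists u.
set q := fun e : R => _.
have eq e : 0 < e -> eproj A (u + e *: v) = u + e *: q e.
  by move=> e0; rewrite /q scalerA divff ?gt_eqF// scale1r [RHS]addrC subrK.
clearbody q; apply: scaled_projection_cvg => // [e e0|e z e0 Az].
  by rewrite -eq//; have [] := eproj_spec (u + e *: v) A0.
have [_ /(_ _ Az)] := eproj_spec (u + e *: v) A0; rewrite eq//.
have -> : u + e *: v - (u + e *: q e) = e *: (v - q e).
  by rewrite opprD addrACA subrr add0r scalerBr.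
have -> : u + e *: z - (u + e *: q e) = e *: (z - q e).
  by rewrite opprD addrACA subrr add0r scalerBr.
by rewrite mdotZl mdotZr !pmulr_rle0.
Qed.

(** A part of Moreau's decomposition: what the projection onto the tangent cone removes from [v]
    lies in the normal cone at [u]. *)
Lemma dproj_normal u v w : A u -> A w -> mdot (v - dproj A u v) (w - u) <= 0.
Proof.
move=> Au Aw; have [l [cl hl]] := dproj_cvg v Au.
by rewrite /dproj (cvg_lim _ cl)//; exact: hl.
Qed.

Lemma dproj_eq0 u v : A u -> (forall w, A w -> mdot v (w - u) <= 0) -> dproj A u v = 0.
Proof.
move=> Au hv; apply: cvg_lim => //; apply: cvg_near_cst.
near=> e; have e0 : 0 < e by [].
rewrite (@variational_eproj u) ?subrr ?scaler0// => w Aw.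
by rewrite addrAC subrr add0r mdotZl pmulr_rle0// hv.
Unshelve. all: by end_near. Qed.

End Projection.

(** * Saddle points *)

Section SaddlePoint.
Context {R : realType} {N n : nat}.
Variables (Omega : 'I_N -> set 'rV[R]_n) (d : 'I_N -> 'rV[R]_n).
Variables (f : 'I_N -> 'rV[R]_n -> R) (omega : R).
Hypotheses (hclosed : forall i, closed (Omega i))
  (hconvex : forall i, convex_set (Omega i))
  (hf : forall i, convexf (f i)) (homega : 0 < omega)
  (hstrong : forall i, strongly_convex_on omega (Omega i) (f i))
  (hslater : slater Omega d).
Implicit Types (x y : 'M[R]_(N, n)) (nu : 'rV[R]_n).

Definition saddle x nu : Prop :=
  [/\ rowsum x = \sum_i d i, forall i, Omega i (row i x) &
    forall i (y : 'rV[R]_n), Omega i y -> f i (row i x) + mdot nu (y - row i x) <= f i y].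

Let K := [set y : 'M[R]_(N, n) | forall i, Omega i (row i y)].
Let F y := \sum_i f i (row i y).
Let z y := rowsum y - \sum_i d i.

Let cK : closed K.
Proof.
have -> : K = \bigcap_i ((fun y => row i y) @^-1` Omega i).
  by apply/seteqP; split=> y Ky i => [_|]; exact: Ky.
apply: closed_bigI => i _; apply: preimage_closed; last exact: hclosed.
move=> y _; apply: (@cvg_mx_coord _ _ (nbhs y)) => k j.
rewrite mxE; under eq_fun do rewrite mxE.
exact: coord_continuous.
Qed.

Let row_conv (t : R) x y i :
  row i ((1 - t) *: x + t *: y) = (1 - t) *: row i x + t *: row i y.
Proof. by apply/rowP => j; rewrite !mxE. Qed.

Let vK (t : R) x y : 0 <= t -> t <= 1 -> K x -> K y -> K ((1 - t) *: x + t *: y).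
Proof.
move=> t0 t1 Kx Ky i; rewrite row_conv.
exact: (convex_set_conv (@hconvex i) t0 t1 (Kx i) (Ky i)).
Qed.

Let vF (t : R) x y : 0 <= t -> t <= 1 ->
  F ((1 - t) *: x + t *: y) <= (1 - t) * F x + t * F y.
Proof.
move=> t0 t1; rewrite /F !mulr_sumr -big_split/=; apply: ler_sum => i _.
by rewrite row_conv; exact: hf.
Qed.

Let zconv (t : R) x y : z ((1 - t) *: x + t *: y) = z x + t *: (z y - z x).
Proof.
rewrite /z !rowsumE mulmxDr -!scalemxAr.
by apply/rowP => j; rewrite !mxE; ring.
Qed.

Let subF x : K x -> exists G : 'M[R]_(N, n), forall y, K y ->
  F x + mdot G (y - x) + omega / 4 * mdot (y - x) (y - x) <= F y.
Proof.
move=> Kx; have /choice[g hg] i := subgradient_exists (row i x) (@hf i).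
exists (\matrix_i g i) => y Ky; rewrite !mdot_rows mulr_sumr -!big_split/=.
apply: ler_sum => i _; rewrite rowK linearB/=.
exact: (strongly_convex_growth (@hf i) (@hconvex i) (@hstrong i) (Kx i) (Ky i) (hg i)).
Qed.

Let coerF : K !=set0 -> exists c m : R, 0 < m /\ forall y, K y -> c + m * mdot y y <= F y.
Proof.
move=> [a Ka]; have [G hG] := subF Ka.
(* Young's inequality spends [omega / 16] of the growth coefficient [omega / 4] on the linear term;
   of the rest, [omega / 8] suffices to dominate [omega / 16 * mdot y y] up to a multiple of
   [mdot a a]. *)
have o8 : 0 < omega / 8 by rewrite divr_gt0.
exists (F a - (omega / 8)^-1 * mdot G G / 2 - omega / 8 * mdot a a), (omega / 16).
split=> [|y Ky]; first by rewrite divr_gt0.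
have := hG y Ky; have := mdot_young (- (y - a)) G o8.
have : omega * mdot y y <= omega * (2 * mdot (y - a) (y - a) + 2 * mdot a a).
  rewrite ler_wpM2l ?(ltW homega)//.
  have := mdot_ge0 (y - 2 *: a); rewrite !mdot_lin (mdotC a y); lra.
have := mulr_ge0 (ltW homega) (mdot_ge0 (y - a)).
rewrite [mdot (- (y - a)) G]mdotNl [mdot (- _) (- _)]mdotNl mdotNr opprK.
rewrite (mdotC (y - a) G).
move: (mdot y y) (mdot (y - a) (y - a)) (mdot G (y - a)) (F y) => p q r s.
move: (F a) (mdot a a) (_ * mdot G G) => t u v.
lra.
Qed.

(** The points on the line through [u] and [v] stay in the affine hull, and those close to [u] fall
    in the neighbourhood given by [relint]. *)
Lemma relint_extend (A : set 'rV[R]_n) u v : relint A u -> A v ->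
  \forall s \near 0^'+, A (u - s *: (v - u)).
Proof.
move=> [Au hu] Av.
have hul (s : R) : affine_hull A (u - s *: (v - u)).
  move=> B [aB AB]; have := aB u v (- s) (AB _ Au) (AB _ Av).
  by congr B; apply/rowP => j; rewrite !mxE; ring.
have [e e0 he] := nbhs_mdot hu.
have k0 : 0 < mdot (v - u) (v - u) + 1 by rewrite ltr_wpDl// mdot_ge0.
near=> s; apply: he (hul s); rewrite addrAC subrr add0r mdotNl mdotNr opprK mdotZl mdotZr.
have s0 : 0 < s by [].
have s1 : s < 1 by near: s; exact: nbhs_right_lt.
have : s < e / (mdot (v - u) (v - u) + 1).
  by near: s; apply: nbhs_right_lt; rewrite divr_gt0.
rewrite ltr_pdivlMr// => se; apply: le_lt_trans se; rewrite ler_wpM2l ?(ltW s0)//.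
have := mdot_ge0 (v - u); nra.
Unshelve. all: by end_near. Qed.

(** Optimality condition for the cost [F + k / 2 |z| ^ 2], obtained by comparing [x] with the
    segment to [y]: [x] minimizes [F] plus the linear term [k <z x, z y>] over [K], so [- k *: z x]
    acts as a multiplier. *)
Let penalized (k : R) : 0 < k -> K !=set0 ->
  exists2 x, K x & forall y, K y -> F x + k * mdot (z x) (z x - z y) <= F y.
Proof.
move=> k0 K0.
have [||x Kx xmin] := @subdiff_coercive_minimizer R N n K
    (fun y => F y + k / 2 * mdot (z y) (z y)) cK K0.
- move=> a Ka; have [G hG] := subF Ka.
  exists (G + k *: rowcst (z a)) => y Ky; have := hG y Ky.
  have -> : mdot (G + k *: rowcst (z a)) (y - a) = mdot G (y - a) + k * mdot (z a) (z y - z a).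
    by rewrite mdotDl mdotZl mdot_rowcst /z rowsumB opprB addrA subrK.
  have -> : mdot (z y) (z y) = mdot (z a) (z a) + 2 * mdot (z a) (z y - z a)
      + mdot (z y - z a) (z y - z a).
    by move: (z y) (z a) => p q; rewrite !mdot_lin (mdotC q p); ring.
  have : 0 <= omega / 4 * mdot (y - a) (y - a) by rewrite mulr_ge0 ?mdot_ge0 ?divr_ge0 ?(ltW homega).
  have := mdot_ge0 (z y - z a); nra.
- move=> C; have [c [m [m0 hc]]] := coerF K0; exists ((C - c) / m) => y Ky yC.
  rewrite ler_pdivlMr// mulrC lerBrDl; apply: le_trans (hc y Ky) (le_trans _ yC).
  by rewrite lerDl mulr_ge0 ?mdot_ge0 ?divr_ge0 ?(ltW k0).
exists x => // y Ky; rewrite leNgt; apply/negP => lt_F.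
set D := z x - z y in lt_F.
have D0 : 0 <= k * mdot D D by rewrite mulr_ge0 ?mdot_ge0// ltW.
pose c := F x + k * mdot (z x) D - F y; have c0 : 0 < c by rewrite subr_gt0.
pose t := c / (c + k * mdot D D).
have cD : 0 < c + k * mdot D D by lra.
have t0 : 0 < t by rewrite divr_gt0.
have t1 : t <= 1 by rewrite ler_pdivrMr//; lra.
have tD : t * (k * mdot D D) <= c.
  by rewrite /t mulrAC ler_pdivrMr// ler_wpM2l ?(ltW c0)//; lra.
have := xmin _ (vK (ltW t0) t1 Kx Ky); rewrite /= zconv.
have := vF x y (ltW t0) t1.
have -> : z x + t *: (z y - z x) = z x - t *: D by rewrite -[z y - z x]opprB scalerN.
have -> : mdot (z x - t *: D) (z x - t *: D) =
    mdot (z x) (z x) - 2 * t * mdot (z x) D + t ^+ 2 * mdot D D.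
  by move: (z x) (D) => p q; rewrite !mdot_lin (mdotC q p); ring.
move=> h1 h2.
have : t * (c - t * (k * mdot D D) / 2) <= 0.
  by rewrite /c; move: h1 h2 => {tD cD t1 t0 c0 xmin}; lra.
rewrite leNgt => /negP; apply; rewrite mulr_gt0//; lra.
Qed.

(** When [z a = 0], the reflected point has a constraint defect that is a negative multiple of that
    of [y]; a one-sided bound valid on all of [K] thus becomes two-sided. *)
Let slater_reflect a y : (forall i, relint (Omega i) (row i a)) -> K y ->
  exists2 s : R, 0 < s & K (a - s *: (y - a)).
Proof.
move=> ra Ky.
have : \forall s \near (0 : R)^'+, 0 < s /\ K (a - s *: (y - a)).
  near=> s; split => // i; move: i; near: s; apply: filter_forall => i.
  have := relint_extend (ra i) (Ky i); apply: filterS => s.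
  by congr (Omega i _); apply/rowP => j; rewrite !mxE.
by move=> /filter_ex[s [s0 Ks]]; exists s.
Unshelve. all: by end_near. Qed.

Let zB x y : z x - z y = rowsum (x - y).
Proof. by rewrite /z opprB addrA subrK rowsumB. Qed.

(* If the multipliers [nu_k = - k z(x_k)] were unbounded, a cluster point of the
   normalized ones would be orthogonal to every [z y] by Slater's condition, hence
   to the [nu_k] themselves. *)
Let multiplier_bounded a (x : nat -> 'M[R]_(N, n)) :
  (forall i, relint (Omega i) (row i a)) -> z a = 0 -> (forall k, K (x k)) ->
  (forall k y, K y -> F (x k) + k.+1%:R * mdot (z (x k)) (z (x k) - z y) <= F y) ->
  exists B : R, forall k, mdot (k.+1%:R *: z (x k)) (k.+1%:R *: z (x k)) <= B.
Proof.
move=> ra za Kx hx; apply: contrapT => unb.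
have Ka : K a by move=> i; have [] := ra i.
have [c [m [m0 hc]]] : exists c m : R, 0 < m /\ forall y, K y -> c + m * mdot y y <= F y.
  by apply: coerF; exists a.
have cF y : K y -> c <= F y.
  by move=> Ky; apply: le_trans (hc y Ky); rewrite lerDl mulr_ge0 ?mdot_ge0 ?(ltW m0).
pose nu k := k.+1%:R *: z (x k).
have /choice[k hk] (B : nat) : exists k, B.+1%:R < mdot (nu k) (nu k).
  apply: contrapT => nB; apply: unb; exists B.+1%:R => k; rewrite leNgt.
  by apply/negP => h; apply: nB; exists k.
have nuy y : K y -> exists C : R, forall k, `|mdot (nu k) (z y)| <= C.
  move=> Ky; have [s s0 Ky'] := slater_reflect ra Ky.
  set y' := a - _ in Ky'.
  have zy' : z y' = - (s *: z y).
    rewrite -[z y']subr0 -za zB /y' addrAC subrr add0r.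
    by rewrite -[z y]subr0 -za zB !rowsumE mulmxN scalemxAr.
  have up w j : K w -> - mdot (nu j) (z w) <= F w - c.
    move=> Kw; have := hx j w Kw; have := cF _ (Kx j).
    have : 0 <= j.+1%:R * mdot (z (x j)) (z (x j)) by rewrite mulr_ge0 ?mdot_ge0.
    rewrite /nu mdotZl; move: (z (x j)) (z w) => p q; rewrite mdotDr mdotNr mulrDr mulrN.
    lra.
  exists (F y - c + (F y' - c) / s) => j.
  have h1 := up y j Ky; have := up y' j Ky'.
  rewrite zy' mdotNr mdotZr opprK -ler_pdivlMl// mulrC => h2.
  have := cF _ Ky; have : 0 <= (F y' - c) / s by rewrite divr_ge0 ?(ltW s0)// subr_ge0 cF.
  by rewrite ler_norml; lra.
pose r j := Num.sqrt (mdot (nu (k j)) (nu (k j))).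
have nu0 j : 0 < mdot (nu (k j)) (nu (k j)) by apply: lt_trans (hk j).
have r0 j : 0 < r j by rewrite sqrtr_gt0.
have r2 j : r j ^+ 2 = mdot (nu (k j)) (nu (k j)) by rewrite sqr_sqrtr// ltW.
pose u j := (r j)^-1 *: nu (k j).
have u1 j : mdot (u j) (u j) = 1.
  by rewrite mdotZl mdotZr mulrA -invfM -expr2 r2 mulVf// gt_eqF.
have [|l hl] := @bounded_mx_cluster R _ \oo _ 1 n u 1.
  by near=> j; rewrite u1.
have lz y : K y -> mdot l (z y) = 0.
  move=> Ky; have [C hC] := nuy y Ky.
  have C0 : 0 <= C by apply: le_trans (hC 0%N).
  apply/eqP; rewrite -normr_le0; apply/ler_addgt0Pr => e e0; rewrite add0r.
  have e2 : 0 < e / 2 by rewrite divr_gt0.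
  have [d0 d00 hd] := mdot_small (z y) e2.
  have [|j jb jl] := hl d0 d00 [set j | C / (e / 2) <= r j].
    (* By [hk] the square of [r j] exceeds [j + 1], hence from this index on also the square of
       [C / (e / 2)]. *)
    exists (Num.truncn ((C / (e / 2)) ^+ 2)) => // j /= jb.
    have Ce : 0 <= C / (e / 2) by rewrite divr_ge0 ?(ltW e2).
    rewrite -(ler_sqr (x := C / _)) ?nnegrE ?(ltW (r0 j))// r2.
    apply: le_trans (ltW (hk j)); apply: le_trans (ltW (truncnS_gt _)) _.
    by rewrite ler_nat ltnS.
  have -> : l = u j - (u j - l) by rewrite subKr.
  rewrite mdotDl mdotNl (mdotC (u j - l)).
  apply: le_trans (ler_normD _ _) _; rewrite normrN [leRHS]splitr lerD//; last exact: ltW (hd _ jl).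
  rewrite mdotZl normrM ger0_norm ?invr_ge0 ?(ltW (r0 j))// ler_pdivrMl//.
  by apply: le_trans (hC _) _; move: jb; rewrite /= ler_pdivrMr// mulrC.
have lu j : mdot l (u j) = 0.
  by rewrite mdotZr /nu mdotZr lz ?mulr0.
(* A unit vector orthogonal to [l] has squared distance [1 + mdot l l] from it, so it cannot be
   closer than 1. *)
have [|j _] := hl 1 ltr01 setT; first exact: filterT.
move: (u j) (lu j) (u1 j) => w lw w1; have := mdot_ge0 l.
by rewrite !mdot_lin (mdotC w l) lw w1; lra.
Unshelve. all: by end_near. Qed.

Lemma saddle_exists : exists x nu, saddle x nu.
Proof.
have [a za0 ra] := hslater.
have za : z a = 0 by rewrite /z /rowsum za0 subrr.
have Ka : K a by move=> i; have [] := ra i.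
have K0 : K !=set0 by exists a.
have /choice[x hx] (k : nat) : exists x, K x /\ forall y, K y ->
    F x + k.+1%:R * mdot (z x) (z x - z y) <= F y.
  by have [x Kx hx] := penalized (ltr0Sn R k) K0; exists x.
have Kx k : K (x k) by have [] := hx k.
have {}hx k y : K y -> F (x k) + k.+1%:R * mdot (z (x k)) (z (x k) - z y) <= F y.
  by have [_] := hx k; apply.
have [B hB] := multiplier_bounded ra za Kx hx.
pose nu k := - (k.+1%:R *: z (x k)).
have nuB k : mdot (nu k) (nu k) <= B by rewrite mdotNl mdotNr opprK.
have [c [m [m0 hc]]] := coerF K0.
have Fxk k : F (x k) + k.+1%:R * mdot (z (x k)) (z (x k)) <= F a.
  by have := hx k a Ka; rewrite za subr0.
have zz0 k : 0 <= k.+1%:R * mdot (z (x k)) (z (x k)) by rewrite mulr_ge0 ?mdot_ge0.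
have xB k : mdot (x k) (x k) <= (F a - c) / m.
  rewrite ler_pdivlMr// mulrC lerBrDl; apply: le_trans (hc _ (Kx k)) _.
  by have := Fxk k; have := zz0 k; lra.
have zB' k : mdot (z (x k)) (z (x k)) <= (F a - c) / k.+1%:R.
  rewrite ler_pdivlMr// mulrC lerBrDl; apply: le_trans (Fxk k).
  rewrite lerD2r; apply: le_trans (hc _ (Kx k)).
  by rewrite lerDl mulr_ge0 ?mdot_ge0 ?(ltW m0).
have mdot_col (p q : 'M[R]_(N, n)) (r s : 'rV[R]_n) :
    mdot (col_mx p r) (col_mx q s) = mdot p q + mdot r s.
  by rewrite /mdot tr_col_mx mul_col_row mxtrace_block.
(* Stacking [x k] and [nu k] makes both approach their limits along common indices. *)
have [|l hl] := @bounded_mx_cluster R _ \oo _ (N + 1) n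
    (fun k => col_mx (x k) (nu k)) ((F a - c) / m + B).
  by near=> k; rewrite mdot_col lerD.
pose xs := usubmx l; pose ns := dsubmx l.
have {}hl (e : R) : 0 < e -> forall j : nat, exists2 k, (j <= k)%N &
    mdot (x k - xs) (x k - xs) < e /\ mdot (nu k - ns) (nu k - ns) < e.
  move=> e0 j; have [|k jk kl] := hl e e0 [set k | (j <= k)%N]; first by exists j.
  exists k => //; move: kl; rewrite -[l]vsubmxK opp_col_mx add_col_mx mdot_col.
  rewrite -/xs -/ns; have := mdot_ge0 (x k - xs); have := mdot_ge0 (nu k - ns).
  by move: (mdot _ _) (mdot _ _) => p q; split; lra.
have Kxs : K xs.
  apply: (@closed_mdot _ _ _ K xs cK) => e e0.
  by have [k _ [ke _]] := hl e e0 0%N; exists (x k).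
have zxs : z xs = 0.
  apply/mdot_eq0/eqP; rewrite eq_le mdot_ge0 andbT; apply/ler_addgt0Pr => e e0.
  have e4 : 0 < e / 4 by rewrite divr_gt0.
  have [d0 d00 hd] := mdot_small (@rowcst R N n (z xs)) e4.
  have [k jk [kx _]] := hl d0 d00 (Num.truncn ((F a - c) / (e / 2))).
  have Fac : 0 <= F a - c.
    rewrite subr_ge0; apply: le_trans (hc _ Ka).
    by rewrite lerDl mulr_ge0 ?mdot_ge0 ?(ltW m0).
  have zk : mdot (z (x k)) (z (x k)) <= e / 2.
    apply: le_trans (zB' k) _; rewrite ler_pdivrMr// mulrC -ler_pdivrMr ?divr_gt0//.
    by apply: le_trans (ltW (truncnS_gt _)) _; rewrite ler_nat ltnS.
  have := hd _ kx; rewrite mdot_rowcst -zB ltr_norml => /andP[+ _].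
  move: (z xs) (z (x k)) zk => p q zk; rewrite mdotDr mdotNr.
  have := mdot_ge0 (p - q); rewrite !mdot_lin (mdotC q p); lra.
(* The affine minorant of [F] at [xs] bounds [F (x k)] from below in the limit, and the penalty term
   is dropped by its sign. *)
have main y : K y -> F xs + mdot ns (z y) <= F y.
  move=> Ky; apply/ler_addgt0Pr => e e0.
  have e2 : 0 < e / 2 by rewrite divr_gt0.
  have [G hG] := subF Kxs.
  have [d1 d10 hd1] := mdot_small G e2.
  have [d2 d20 hd2] := mdot_small (z y) e2.
  have dm : 0 < Num.min d1 d2 by rewrite lt_min d10.
  have [k _ []] := hl _ dm 0%N; rewrite !lt_min => /andP[/hd1 h1 _] /andP[_ /hd2 h2].
  have := hG _ (Kx k); have := hx k y Ky; have := zz0 k.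
  have : 0 <= omega / 4 * mdot (x k - xs) (x k - xs).
    by rewrite mulr_ge0 ?mdot_ge0 ?divr_ge0 ?(ltW homega).
  move: h1 h2; rewrite !ltr_norml => /andP[h1 _] /andP[].
  rewrite (mdotDr (nu k)) mdotNr [mdot _ (nu k)]mdotNr mdotZr !(mdotC (z y)) => h2 _.
  rewrite (mdotDr (z (x k))) [mdot _ (- z y)]mdotNr mulrDr mulrN.
  lra.
exists xs, ns; split => // [|i y Oy].
  by apply/eqP; rewrite -subr_eq0; apply/eqP.
(* Changing only row [i] of [xs] isolates the inequality of agent [i] from the summed one. *)
pose y' : 'M[R]_(N, n) := \matrix_j (if j == i then y else row j xs).
have ry j : row j y' = if j == i then y else row j xs by rewrite rowK.
have Ky' : K y' by move=> j; rewrite ry; case: eqVneq => [->|_]; [|exact: Kxs].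
have := main _ Ky'; rewrite -[z y']subr0 -{1}zxs zB.
have -> : rowsum (y' - xs) = y - row i xs.
  rewrite /rowsum (bigD1 i)//= big1 ?addr0 => [|j /negPf ji].
    by rewrite linearB/= ry eqxx.
  by rewrite linearB/= ry ji subrr.
rewrite /F (bigD1 i)//= [X in _ <= X](bigD1 i)//= ry eqxx.
rewrite (eq_bigr (fun j => f j (row j xs)) (F1 := fun j => f j (row j y'))); last first.
  by move=> j /negPf ji; rewrite ry ji.
lra.
Unshelve. all: by end_near. Qed.

End SaddlePoint.

(** * Saddle points as equilibria and unique optima *)

Section Equilibrium.
Context {R : realType} {N n : nat}.
Variables (G : wdigraph R N) (Omega : 'I_N -> set 'rV[R]_n) (d : 'I_N -> 'rV[R]_n).
Variables (f : 'I_N -> 'rV[R]_n -> R) (omega k1 k2 k3 : R).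
Hypotheses (hclosed : forall i, closed (Omega i))
  (hconvex : forall i, convex_set (Omega i))
  (hf : forall i, convexf (f i)) (homega : 0 < omega)
  (hstrong : forall i, strongly_convex_on omega (Omega i) (f i)).
Local Notation L := (laplacian G).
Local Notation dmx := (\matrix_i d i).

Lemma saddle_subgradients x nu : saddle Omega d f x nu ->
  exists g : 'I_N -> 'rV[R]_n, forall i, subdiff (f i) (row i x) (g i) /\
    forall y, Omega i y -> mdot (nu - g i) (y - row i x) <= 0.
Proof.
move=> [_ Ox sx].
have /choice[g hg] i : exists g, subdiff (f i) (row i x) g /\
    forall y, Omega i y -> mdot (nu - g) (y - row i x) <= 0.
  have [g g1 g2] := constrained_subgradient (@hf i) (@hconvex i) (Ox i) (sx i).
  by exists g.
by exists g.
Qed.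

(** For feasible [y] the multiplier term vanishes, and summing the quadratic growth over the agents
    leaves a surplus of [omega / 4] times the squared distance, which gives optimality and
    uniqueness together. *)
Lemma saddle_unique_optimal x nu : saddle Omega d f x nu ->
  unique (optimal Omega f d) x.
Proof.
move=> sx; have [rx Ox _] := sx; have [g hg] := saddle_subgradients sx.
have key y : feasible Omega d y ->
    \sum_i f i (row i x) + omega / 4 * mdot (y - x) (y - x) <= \sum_i f i (row i y).
  move=> [ry Oy].
  have ny : mdot (rowcst nu) (y - x) = 0.
    by rewrite mdot_rowcst rowsumB rx [rowsum y]ry subrr mdot0r.
  rewrite -[leLHS]addr0 -[X in _ + X <= _]ny (mdot_rows (y - x)) (mdot_rows (rowcst nu) (y - x)) mulr_sumr -!big_split/=.
  apply: ler_sum => i _; rewrite row_rowcst linearB/=.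
  have [gi ni] := hg i.
  have := strongly_convex_growth (@hf i) (@hconvex i) (@hstrong i) (Ox i) (Oy i) gi.
  by have := ni _ (Oy i); rewrite mdotDl mdotNl; lra.
have o4 : 0 < omega / 4 by rewrite divr_gt0.
split=> [|y [Fy opt]].
  split=> // y Fy; apply: le_trans (key y Fy).
  by rewrite lerDl mulr_ge0 ?mdot_ge0 ?(ltW o4).
have := le_trans (key y Fy) (opt x (conj rx Ox)).
rewrite gerDl pmulr_rle0// => h.
apply/esym/eqP; rewrite -subr_eq0; apply/eqP/mdot_eq0/eqP.
by rewrite eq_le h mdot_ge0.
Qed.

Lemma saddle_equilibrium x nu : saddle Omega d f x nu ->
  equilibrium G Omega f d k1 k2 k3 x (rowcst nu) (x - dmx).
Proof.
move=> sx; have [rx Ox _] := sx; have [g hg] := saddle_subgradients sx.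
split=> // i /=; have [gi ni] := hg i.
have r0 j : row j (x - dmx) - row j x + d j = 0.
  by rewrite linearB/= rowK addrAC subrK subrr.
split.
- rewrite row0; split=> //; exists (- g i + row i (rowcst nu)).
    by exists (g i).
  rewrite row_rowcst; apply/esym/dproj_eq0 => // w Ow.
  by rewrite addrC; exact: ni.
- rewrite row0 r0 scaler0 big1 ?scaler0 ?subrr// => j _.
  by rewrite !row_rowcst subrr scaler0.
- by rewrite row0 big1 ?scaler0// => j _; rewrite !r0 subrr scaler0.
Qed.

(* The right-hand side in matrix form, with the inclusion replaced by the
   variational inequality it implies. *)
Lemma dynamics_rhsE x mu eta x' mu' eta' :
  dynamics_rhs G Omega f d k1 k2 k3 x mu eta (x', mu', eta') ->
  [/\ forall i, Omega i (row i x),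
      forall i, exists2 g, subdiff (f i) (row i x) g & forall y, Omega i y ->
        mdot (row i mu - g - row i x') (y - row i x) <= 0,
      mu' = k1 *: (eta - x + dmx) - k2 *: (L *m mu)
    & eta' = - k3 *: (L *m (eta - x + dmx))].
Proof.
move=> h.
have rE i : row i (eta - x + dmx) = row i eta - row i x + d i.
  by rewrite linearD linearB/= rowK.
split.
- by move=> i; have [[]] := h i.
- move=> i; have [/= [Oi [_ [g gi <-] ->]] _ _] := h i; exists g => // y Oy.
  by rewrite [row i mu - g]addrC; exact: dproj_normal.
- apply/row_matrixP => i; have [_ /= -> _] := h i.
  have -> (a b : R) (A B : 'M[R]_(N, n)) : row i (a *: A - b *: B) = a *: row i A - b *: row i B.
    by apply/rowP => j; rewrite !mxE.
  by rewrite rE row_laplacian.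
- apply/row_matrixP => i; have [_ _ /= ->] := h i.
  have -> (a : R) (A : 'M[R]_(N, n)) : row i (a *: A) = a *: row i A.
    by apply/rowP => j; rewrite !mxE.
  rewrite row_laplacian; congr (_ *: _); apply: eq_bigr => j _.
  by rewrite !rE.
Qed.

(** Three inequalities are added for each agent: the normal-cone inequality at [x] tested at [xs],
    the one at [xs] tested at [x], and strong monotonicity of the two subgradients. *)
Lemma saddle_descent xs nu x mu x' : saddle Omega d f xs nu ->
  (forall i, Omega i (row i x)) ->
  (forall i, exists2 g, subdiff (f i) (row i x) g & forall y, Omega i y ->
        mdot (row i mu - g - row i x') (y - row i x) <= 0) ->
  mdot x' (x - xs) <= - omega * mdot (x - xs) (x - xs) + mdot (mu - rowcst nu) (x - xs).
Proof.
move=> sx Ox hx'; have [_ Oxs _] := sx; have [gs hgs] := saddle_subgradients sx.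
rewrite (mdot_rows x') (mdot_rows (x - xs)) (mdot_rows (mu - _)) mulr_sumr -big_split/=.
apply: ler_sum => i _; rewrite !linearB/= row_rowcst.
have [gsi nsi] := hgs i; have [g gi ni] := hx' i.
have := @hstrong i _ _ _ _ (Ox i) (Oxs i) gi gsi; rewrite enormE dotpE.
have := nsi _ (Ox i); have := ni _ (Oxs i).
rewrite -[row i xs - row i x]opprB mdotNr.
move: (row i x - row i xs) => X; rewrite (mdotC X (g - _)) !mdotDl !mdotNl; lra.
Qed.

End Equilibrium.

(** * Dissipation estimates *)

Section Dissipation.
Context {R : realType} {N n : nat}.
Variables (G : wdigraph R N) (lam omega k1 k2 k3 : R).
Local Notation L := (laplacian G).
Local Notation l2 := (spectral_norm L ^+ 2).
Hypotheses (N0 : (0 < N)%N) (hbal : weight_balanced G) (lam0 : 0 < lam).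
Hypothesis gap : forall X : 'M[R]_(N, n), rowsum X = 0 -> lam * mdot X X <= mdot (L *m X) X.
Hypotheses (k1_gt0 : 0 < k1) (k2_ge0 : 0 <= k2) (k3_gt0 : 0 < k3).
Implicit Types X M E : 'M[R]_(N, n).

Lemma mdot_laplacian_center M :
  mdot M (L *m M) = mdot (L *m center M) (center M).
Proof.
by rewrite laplacian_center -(mdot_centerl _ (rowsum_laplacian hbal M)) mdotC.
Qed.

Lemma lyapunov_dissipation X M E X' : rowsum E = 0 ->
  mdot X' X <= - omega * mdot X X + mdot M X ->
  k1 * mdot X' X + mdot M (k1 *: (E - X) - k2 *: (L *m M)) +
    2 / k3 * mdot E (- k3 *: (L *m (E - X))) <=
  - (k1 * omega - l2 / lam) * mdot X X
  - (k2 * lam - k1 ^+ 2 / (2 * lam)) * mdot (center M) (center M)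
  - lam / 2 * mdot E E.
Proof.
move=> E0 hX.
have gE := gap E0; have gM := gap (rowsum_center N0 M).
have h1 := ler_wpM2l (ltW k1_gt0) hX.
(* Out of the coefficient [2 * lam] that the gap gives for [E], these weights spend [lam / 2] on
   [k1 <M, E>] and [lam] on [2 <E, L X>], leaving [lam / 2]. *)
have lamV : 0 < lam^-1 by rewrite invr_gt0.
have y1 := mdot_young (k1 *: center M) E lamV.
rewrite invrK [mdot (k1 *: _) E]mdotZl (mdot_centerl _ E0) mdotZl mdotZr in y1.
have y2 := mdot_young E (L *m X) lam0.
have y3 : lam^-1 * mdot (L *m X) (L *m X) <= lam^-1 * (l2 * mdot X X).
  by rewrite ler_wpM2l ?spectral_norm_mulmx ?ltW.
have h2 := ler_wpM2l k2_ge0 gM.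
have -> : mdot M (k1 *: (E - X) - k2 *: (L *m M)) =
    k1 * (mdot M E - mdot M X) - k2 * mdot (L *m center M) (center M).
  rewrite -mdot_laplacian_center; move: (L *m M) => Q.
  by rewrite !mdot_lin.
have -> : 2 / k3 * mdot E (- k3 *: (L *m (E - X))) = - 2 * (mdot (L *m E) E - mdot E (L *m X)).
  by rewrite mulmxBr mdotZr mdotDr mdotNr (mdotC E (L *m E)); field; rewrite gt_eqF.
have -> : k1 ^+ 2 / (2 * lam) = k1 ^+ 2 * lam^-1 / 2 by field; rewrite gt_eqF.
lra.
Qed.

Lemma mdot_center_le M : mdot (center M) (center M) <= mdot M M.
Proof.
have h := mdot_centerl M (rowsum_center N0 M).
have := mdot_ge0 (M - center M); move: (center M) h => P h.
by rewrite !mdot_lin (mdotC P M) h; lra.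
Qed.

Lemma sqnorm_derivative_le X M X' : 0 <= omega ->
  mdot X' X <= - omega * mdot X X + mdot M X ->
  mdot X X' + mdot X' X <= mdot M M + mdot X X.
Proof.
move=> o0 h; have := mdot_young M X ltr01; rewrite invr1 !mul1r (mdotC X X').
have := mulr_ge0 o0 (mdot_ge0 X); lra.
Qed.

Lemma sqnorm_consensus_derivative_le X E : rowsum E = 0 ->
  2 * mdot E (- k3 *: (L *m (E - X))) <= k3 * (mdot E E + l2 * mdot X X).
Proof.
move=> E0; have gE := gap E0.
have y2 := mdot_young E (L *m X) ltr01; rewrite invr1 !mul1r in y2.
have y3 := spectral_norm_mulmx L X.
rewrite mulmxBr mdotZr mdotDr mdotNr (mdotC E (L *m E)).
have : 0 <= mdot (L *m E) E by apply: le_trans gE; rewrite mulr_ge0 ?mdot_ge0 ?(ltW lam0).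
move: (mdot (L *m E) E) => p p0.
have : k3 * (- (2 * p) + 2 * mdot E (L *m X)) <= k3 * (mdot E E + l2 * mdot X X).
  by rewrite ler_wpM2l ?(ltW k3_gt0)//; lra.
lra.
Qed.

Lemma sqnorm_center_derivative_le X M E :
  2 * mdot (center M) (k1 *: (E - X) - k2 *: (L *m M)) <=
  k1 * (mdot M M + 2 * mdot E E + 2 * mdot X X).
Proof.
have -> : mdot (center M) (k1 *: (E - X) - k2 *: (L *m M)) =
    k1 * mdot (center M) (E - X) - k2 * mdot (L *m center M) (center M).
  rewrite laplacian_center (mdotC (L *m M)).
  by move: (center M) (L *m M) => P Q; rewrite !mdot_lin; ring.
have gM := gap (rowsum_center N0 M).
have : 0 <= k2 * mdot (L *m center M) (center M).
  rewrite mulr_ge0//; apply: le_trans gM; rewrite mulr_ge0 ?mdot_ge0 ?(ltW lam0)//.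
have y := mdot_young (center M) (E - X) ltr01; rewrite invr1 !mul1r in y.
have := mdot_center_le M; have := mdot_ge0 (E + X).
have e : mdot (E - X) (E - X) + mdot (E + X) (E + X) = 2 * mdot E E + 2 * mdot X X.
  by rewrite !mdot_lin (mdotC X E); ring.
move=> h1 h2 h3.
have : k1 * (2 * mdot (center M) (E - X)) <= k1 * (mdot M M + 2 * mdot E E + 2 * mdot X X).
  by rewrite ler_wpM2l ?(ltW k1_gt0)//; lra.
lra.
Qed.

(** The three squares on the right tend to 0 along a trajectory, so this controls the speed of [mu]
    itself. *)
Lemma sqnorm_multiplier_derivative_le X M E :
  mdot (k1 *: (E - X) - k2 *: (L *m M)) (k1 *: (E - X) - k2 *: (L *m M)) <=
  4 * k1 ^+ 2 * (mdot E E + mdot X X) + 2 * k2 ^+ 2 * l2 * mdot (center M) (center M).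
Proof.
rewrite -laplacian_center.
have y3 := ler_wpM2l (sqr_ge0 k2) (spectral_norm_mulmx L (center M)).
have e : mdot (E - X) (E - X) <= 2 * mdot E E + 2 * mdot X X.
  by have := mdot_ge0 (E + X); rewrite !mdot_lin (mdotC X E); lra.
have := ler_wpM2l (sqr_ge0 k1) e.
move: (E - X) (L *m center M) (mdot (center M) (center M)) y3 => p q r y3 h.
have := mdot_ge0 (k1 *: p + k2 *: q); rewrite !mdot_lin (mdotC q p); lra.
Qed.

End Dissipation.

(** * Convergence of trajectories *)

Lemma center_mulmx (R : realType) N n (X : 'M[R]_(N, n)) :
  center X = (1%:M - N%:R^-1 *: const_mx 1) *m X.
Proof.
rewrite mulmxBl mul1mx -scalemxAl; congr (_ - _); apply/row_matrixP => i.
rewrite row_rowcst linearZ/= rowsumE row_mul; congr (_ *: (_ *m _)).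
by apply/rowP => j; rewrite !mxE.
Qed.

Lemma near_pinfty_ge0 (R : realType) (P : R -> Prop) :
  (\forall t \near +oo, P t) -> exists T, 0 <= T /\ forall t, T < t -> P t.
Proof.
move=> [T [_ hT]]; exists `|T|; split=> // t Tt.
by apply: hT; apply: le_lt_trans Tt; exact: ler_norm.
Qed.

Lemma mdot_row_le (R : realType) m n (A : 'M[R]_(m, n)) i :
  mdot (row i A) (row i A) <= mdot A A.
Proof.
rewrite [leRHS]mdot_rows (bigD1 i)//= lerDl sumr_ge0// => j _; exact: mdot_ge0.
Qed.

Section Trajectory.
Context {R : realType} {N n : nat}.
Local Notation leb := (@lebesgue_measure R).
Variables (G : wdigraph R N) (Omega : 'I_N -> set 'rV[R]_n) (d : 'I_N -> 'rV[R]_n).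
Variables (f : 'I_N -> 'rV[R]_n -> R) (lam omega k1 k2 k3 : R).
Local Notation L := (laplacian G).
Local Notation l2 := (spectral_norm L ^+ 2).
Local Notation dmx := (\matrix_i d i).
Hypotheses (N0 : (0 < N)%N) (hbal : weight_balanced G) (lam0 : 0 < lam).
Hypothesis gap : forall X : 'M[R]_(N, n), rowsum X = 0 -> lam * mdot X X <= mdot (L *m X) X.
Hypotheses (hclosed : forall i, closed (Omega i))
  (hconvex : forall i, convex_set (Omega i))
  (hf : forall i, convexf (f i)) (homega : 0 < omega)
  (hstrong : forall i, strongly_convex_on omega (Omega i) (f i)).
Hypotheses (hk1 : l2 / (lam * omega) < k1) (hk2 : k1 ^+ 2 / lam ^+ 2 < k2) (hk3 : 0 < k3).
Variables x mu eta : R -> 'M[R]_(N, n).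
Hypothesis htraj : trajectory G Omega f d k1 k2 k3 x mu eta.
Hypothesis heta0 : \sum_i row i (eta 0) = 0.

Let x' := (x^`()%classic : R -> 'M[R]_(N, n)).
Let mu' := (mu^`()%classic : R -> 'M[R]_(N, n)).
Let eta' := (eta^`()%classic : R -> 'M[R]_(N, n)).

Let k1_gt0 : 0 < k1.
Proof. by apply: le_lt_trans hk1; rewrite divr_ge0 ?sqr_ge0 ?mulr_ge0 ?ltW. Qed.

Let k2_ge0 : 0 <= k2.
Proof. by apply: le_trans (ltW hk2); rewrite divr_ge0 ?sqr_ge0. Qed.

Let cX : 0 < k1 * omega - l2 / lam.
Proof.
rewrite subr_gt0 ltr_pdivrMr//; move: hk1; rewrite ltr_pdivrMr ?mulr_gt0//.
by rewrite -mulrA (mulrC omega).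
Qed.

Let cM : 0 < k2 * lam - k1 ^+ 2 / (2 * lam).
Proof.
have h : k1 ^+ 2 < k2 * lam ^+ 2 by move: hk2; rewrite ltr_pdivrMr ?exprn_gt0.
rewrite subr_gt0 ltr_pdivrMr ?mulr_gt0//.
by have := sqr_ge0 k1; rewrite expr2 in h *; nra.
Qed.

Let cE : 0 < lam / 2.
Proof. by rewrite divr_gt0. Qed.

Let acx : ac_curve x x'.
Proof.
have [ac _ _ _ ae] := htraj; apply: ac_curve_of ac _.
by move: ae; apply: ae_imply => t h t0; have [] := h t0.
Qed.

Let acmu : ac_curve mu mu'.
Proof.
have [_ ac _ _ ae] := htraj; apply: ac_curve_of ac _.
by move: ae; apply: ae_imply => t h t0; have [] := h t0.
Qed.

Let aceta : ac_curve eta eta'.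
Proof.
have [_ _ ac _ ae] := htraj; apply: ac_curve_of ac _.
by move: ae; apply: ae_imply => t h t0; have [] := h t0.
Qed.

Let dyn : {ae leb, forall t, 0 <= t ->
  [/\ forall i, Omega i (row i (x t)),
      forall i, exists2 g, subdiff (f i) (row i (x t)) g & forall y, Omega i y ->
        mdot (row i (mu t) - g - row i (x' t)) (y - row i (x t)) <= 0,
      mu' t = k1 *: (eta t - x t + dmx) - k2 *: (L *m mu t)
    & eta' t = - k3 *: (L *m (eta t - x t + dmx))]}.
Proof.
have [_ _ _ _ ae] := htraj; move: ae; apply: ae_imply => t h t0.
by have [_ _ _ /(dynamics_rhsE hclosed hconvex)] := h t0.
Qed.

(** Weight balance makes the agent sum of [eta'] vanish almost everywhere; the growth comparison,
    applied to each entry and to its opposite, keeps the sum at its initial value. *)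
Lemma rowsum_eta t : 0 <= t -> rowsum (eta t) = 0.
Proof.
move=> t0; rewrite rowsumE; apply/matrixP => i j; rewrite [RHS]mxE.
have ac := ac_curve_mulmx (const_mx 1 : 'rV[R]_N) aceta i j.
have z : {ae leb, forall s, 0 <= s -> ((const_mx 1 : 'rV[R]_N) *m eta' s) i j = 0}.
  move: dyn; apply: ae_imply => s h s0; have [_ _ _ ->] := h s0.
  by rewrite -scalemxAr mulmxA ones_laplacian// mul0mx scaler0 mxE.
have ac2 := ac_funZ (-1) ac.
have e0 : ((const_mx 1 : 'rV[R]_N) *m eta 0) i j = 0.
  by rewrite -rowsumE /rowsum heta0 mxE.
have h1 := @ac_fun_le _ _ _ 0 t 0 ac (lexx _) t0.
have h2 := @ac_fun_le _ _ _ 0 t 0 ac2 (lexx _) t0.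
rewrite /= e0 mul0r in h1 h2.
apply/eqP; rewrite eq_le; apply/andP; split.
  rewrite subr0 in h1; apply: h1; move: z; apply: ae_imply => s h s0 _.
  by rewrite h.
have : -1 * ((const_mx 1 : 'rV[R]_N) *m eta t) i j - -1 * 0 <= 0.
  by apply: h2; move: z; apply: ae_imply => s h s0 _; rewrite h// mulr0.
by rewrite mulr0 subr0 mulN1r oppr_le0.
Qed.

Section AtSaddle.
Variables (xs : 'M[R]_(N, n)) (nu : 'rV[R]_n).
Hypothesis sx : saddle Omega d f xs nu.
Let X t := x t - xs.
Let M t := mu t - rowcst nu.
Let E t := eta t - (xs - dmx).

Let rowsumE0 t : 0 <= t -> rowsum (E t) = 0.
Proof.
move=> t0; rewrite rowsumB rowsum_eta// rowsumB; have [-> _ _] := sx.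
rewrite [rowsum dmx](eq_bigr d) ?subrr ?subr0// => i _; exact: rowK.
Qed.

Let acX : ac_curve X x'. Proof. exact: ac_curveB_cst. Qed.
Let acM : ac_curve M mu'. Proof. exact: ac_curveB_cst. Qed.
Let acE : ac_curve E eta'. Proof. exact: ac_curveB_cst. Qed.

Let acPM : ac_curve (fun t => center (M t)) (fun t => center (mu' t)).
Proof.
have -> : (fun t => center (M t)) = (fun t => (1%:M - N%:R^-1 *: const_mx 1) *m M t).
  by apply/funext => t; rewrite center_mulmx.
have -> : (fun t => center (mu' t)) = (fun t => (1%:M - N%:R^-1 *: const_mx 1) *m mu' t).
  by apply/funext => t; rewrite center_mulmx.
exact: ac_curve_mulmx.
Qed.

Let dynS : {ae leb, forall t, 0 <= t ->
  [/\ mdot (x' t) (X t) <= - omega * mdot (X t) (X t) + mdot (M t) (X t),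
      mu' t = k1 *: (E t - X t) - k2 *: (L *m M t)
    & eta' t = - k3 *: (L *m (E t - X t))]}.
Proof.
move: dyn; apply: ae_imply => t h t0; have [Ox hx -> ->] := h t0.
have -> : E t - X t = eta t - x t + dmx.
  by apply/matrixP => i j; rewrite !mxE; ring.
split => //; first exact: (saddle_descent hconvex hf hstrong sx Ox hx).
by rewrite /M mulmxBr laplacian_rowcst subr0.
Qed.

Definition lyapunov t : R :=
  k1 / 2 * mdot (X t) (X t) + 2^-1 * mdot (M t) (M t) + k3^-1 * mdot (E t) (E t).

Let lyapunov' t : R := k1 / 2 * (mdot (X t) (x' t) + mdot (x' t) (X t)) +
  2^-1 * (mdot (M t) (mu' t) + mdot (mu' t) (M t)) +
  k3^-1 * (mdot (E t) (eta' t) + mdot (eta' t) (E t)).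

Let acV : ac_fun lyapunov lyapunov'.
Proof.
by apply: ac_funD; [apply: ac_funD|]; apply: ac_funZ; apply: ac_fun_mdot.
Qed.

Let dissipation : {ae leb, forall t, 0 <= t -> lyapunov' t <=
  - (k1 * omega - l2 / lam) * mdot (X t) (X t)
  - (k2 * lam - k1 ^+ 2 / (2 * lam)) * mdot (center (M t)) (center (M t))
  - lam / 2 * mdot (E t) (E t)}.
Proof.
move: dynS; apply: ae_imply => t h t0; have [hX hM hE] := h t0.
have := lyapunov_dissipation N0 hbal lam0 gap k1_gt0 k2_ge0 hk3 (rowsumE0 t0) hX.
rewrite -hM -hE; apply: le_trans; rewrite /lyapunov'.
rewrite (mdotC (X t) (x' t)) (mdotC (mu' t) (M t)) (mdotC (eta' t) (E t)).
lra.
Qed.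

Let lyapunov_ge0 t : 0 <= lyapunov t.
Proof.
by rewrite !addr_ge0// mulr_ge0 ?mdot_ge0 ?divr_ge0 ?invr_ge0 ?(ltW k1_gt0) ?(ltW hk3).
Qed.

Lemma lyapunov_nonincreasing s t : 0 <= s -> s <= t -> lyapunov t <= lyapunov s.
Proof.
move=> s0 st; rewrite -subr_le0 -(mul0r (t - s)); apply: (ac_fun_le acV) => //.
move: dissipation; apply: ae_imply => u h su _; apply: le_trans (h (le_trans s0 su)) _.
have := mulr_ge0 (ltW cX) (mdot_ge0 (X u)).
have := mulr_ge0 (ltW cM) (mdot_ge0 (center (M u))).
have := mulr_ge0 (ltW cE) (mdot_ge0 (E u)); lra.
Qed.

Lemma lyapunov_bounds t :
  [/\ mdot (X t) (X t) <= 2 / k1 * lyapunov t, mdot (M t) (M t) <= 2 * lyapunov t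
    & mdot (E t) (E t) <= k3 * lyapunov t].
Proof.
have pX : 0 <= k1 / 2 * mdot (X t) (X t) by rewrite mulr_ge0 ?mdot_ge0 ?divr_ge0 ?(ltW k1_gt0).
have pM : 0 <= 2^-1 * mdot (M t) (M t) by rewrite mulr_ge0 ?mdot_ge0 ?invr_ge0.
have pE : 0 <= k3^-1 * mdot (E t) (E t) by rewrite mulr_ge0 ?mdot_ge0 ?invr_ge0 ?(ltW hk3).
split.
- rewrite -ler_pdivrMl ?divr_gt0// invf_div; rewrite /lyapunov; lra.
- rewrite /lyapunov; lra.
- rewrite -ler_pdivrMl// /lyapunov; lra.
Qed.

Let bounded : exists2 B : R, 0 <= B & forall t, 0 <= t ->
  [/\ mdot (X t) (X t) <= B, mdot (M t) (M t) <= B & mdot (E t) (E t) <= B].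
Proof.
exists ((2 / k1 + 2 + k3) * lyapunov 0).
  by rewrite mulr_ge0// !addr_ge0 ?divr_ge0 ?(ltW k1_gt0) ?(ltW hk3).
move=> t t0; have [bX bM bE] := lyapunov_bounds t.
have V0 := lyapunov_ge0 0; have Vt := lyapunov_nonincreasing (lexx 0) t0.
have h1 : 0 <= 2 / k1 by rewrite divr_ge0 ?(ltW k1_gt0).
have h2 := ltW hk3.
split; [apply: le_trans bX _|apply: le_trans bM _|apply: le_trans bE _].
- by apply: (@le_trans _ _ (2 / k1 * lyapunov 0)); rewrite ?ler_wpM2l// ler_wpM2r//; lra.
- by apply: (@le_trans _ _ (2 * lyapunov 0)); rewrite ?ler_wpM2l// ler_wpM2r//; lra.
- by apply: (@le_trans _ _ (k3 * lyapunov 0)); rewrite ?ler_wpM2l// ler_wpM2r//; lra.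
Qed.

Let barb h dh c C : 0 < c -> ac_fun h dh -> (forall t, 0 <= t -> 0 <= h t) ->
  {ae leb, forall t, 0 <= t -> lyapunov' t <= - c * h t} ->
  {ae leb, forall t, 0 <= t -> dh t <= C} ->
  forall e : R, 0 < e -> \forall t \near +oo, h t < e.
Proof. by move=> c0 ach h0 hV hC; apply: (barbalat c0 acV ach) hV hC => // t _. Qed.

Lemma x_error_vanishes (e : R) : 0 < e -> \forall t \near +oo, mdot (X t) (X t) < e.
Proof.
have [B B0 hB] := bounded.
apply: (@barb _ (fun t => mdot (X t) (x' t) + mdot (x' t) (X t)) _ (B + B) cX).
- exact: ac_fun_mdot.
- by move=> t _; exact: mdot_ge0.
- move: dissipation; apply: ae_imply => t h t0; apply: le_trans (h t0) _.
  have := mulr_ge0 (ltW cM) (mdot_ge0 (center (M t))).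
  have := mulr_ge0 (ltW cE) (mdot_ge0 (E t)); lra.
- move: dynS; apply: ae_imply => t h t0; have [hX _ _] := h t0.
  apply: le_trans (sqnorm_derivative_le (ltW homega) hX) _.
  by have [? ? _] := hB t t0; rewrite lerD.
Qed.

Lemma eta_error_vanishes (e : R) : 0 < e -> \forall t \near +oo, mdot (E t) (E t) < e.
Proof.
have [B B0 hB] := bounded.
apply: (@barb _ (fun t => mdot (E t) (eta' t) + mdot (eta' t) (E t)) _ (k3 * (B + l2 * B)) cE).
- exact: ac_fun_mdot.
- by move=> t _; exact: mdot_ge0.
- move: dissipation; apply: ae_imply => t h t0; apply: le_trans (h t0) _.
  have := mulr_ge0 (ltW cM) (mdot_ge0 (center (M t))).
  have := mulr_ge0 (ltW cX) (mdot_ge0 (X t)); lra.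
- move: dynS; apply: ae_imply => t h t0; have [_ _ hE] := h t0.
  rewrite (mdotC (eta' t)) hE.
  have := sqnorm_consensus_derivative_le lam0 gap hk3 (X t) (rowsumE0 t0).
  have [bX _ bE] := hB t t0.
  have : k3 * (mdot (E t) (E t) + l2 * mdot (X t) (X t)) <= k3 * (B + l2 * B).
    by rewrite ler_wpM2l ?(ltW hk3)// lerD// ler_wpM2l ?sqr_ge0.
  lra.
Qed.

Lemma mu_disagreement_vanishes (e : R) : 0 < e ->
  \forall t \near +oo, mdot (center (M t)) (center (M t)) < e.
Proof.
have [B B0 hB] := bounded.
apply: (@barb _ (fun t => mdot (center (M t)) (center (mu' t)) +
   mdot (center (mu' t)) (center (M t))) _ (k1 * (B + 2 * B + 2 * B)) cM).
- exact: ac_fun_mdot.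
- by move=> t _; exact: mdot_ge0.
- move: dissipation; apply: ae_imply => t h t0; apply: le_trans (h t0) _.
  have := mulr_ge0 (ltW cE) (mdot_ge0 (E t)).
  have := mulr_ge0 (ltW cX) (mdot_ge0 (X t)); lra.
- move: dynS; apply: ae_imply => t h t0; have [_ hM _] := h t0.
  rewrite (mdotC (center (M t)) (center (mu' t))).
  rewrite (mdot_centerl _ (rowsum_center N0 (M t))) (mdotC (mu' t)) hM.
  have := sqnorm_center_derivative_le N0 lam0 gap k1_gt0 k2_ge0 (X t) (M t) (E t).
  have [bX bM bE] := hB t t0.
  have : k1 * (mdot (M t) (M t) + 2 * mdot (E t) (E t) + 2 * mdot (X t) (X t)) <=
      k1 * (B + 2 * B + 2 * B).
    by rewrite ler_wpM2l ?(ltW k1_gt0)//; lra.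
  lra.
Qed.

(** The speed of [mu] tends to 0 with the three errors, so [mu] is nearly constant over late unit
    windows. This lets closeness to a cluster value at one time last for a whole window. *)
Lemma mu_slowly_varying (e : R) : 0 < e ->
  \forall t0 \near +oo, forall s, t0 <= s -> s <= t0 + 1 ->
    mdot (mu s - mu t0) (mu s - mu t0) < e.
Proof.
move=> e0; have [B B0 hB] := bounded.
(* Young weight for [<mu u - mu t0, mu' u>]: with [4 * B] bounding the squared displacement, its
   share is at most [e / 4], and the other share is made at most [e / 4] by waiting. *)
pose sg := e / (4 * (4 * B + 1)).
have sg0 : 0 < sg by rewrite divr_gt0// mulr_gt0//; lra.
have sgB : sg * (4 * B) <= e / 4.
  apply: (@le_trans _ _ (sg * (4 * B + 1))); first by rewrite ler_wpM2l ?(ltW sg0)//; lra.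
  rewrite [leLHS](_ : _ = e / 4)// /sg; field.
  by rewrite gt_eqF//; lra.
(* If the three errors are below [r], the speed estimate gives at most [(c1 - 1) * r]; the added 1
   makes [c1] positive. *)
pose c1 := 8 * k1 ^+ 2 + 2 * k2 ^+ 2 * l2 + 1.
have c10 : 0 < c1.
  have := mulr_ge0 (sqr_ge0 k2) (sqr_ge0 (spectral_norm L)).
  by have := sqr_ge0 k1; rewrite /c1; lra.
have e1 : 0 < sg * (e / 4) / c1.
  have e4 : 0 < e / 4 by rewrite divr_gt0.
  exact: (divr_gt0 (mulr_gt0 sg0 e4) c10).
have [T [T0 hT]] := near_pinfty_ge0 (filterI (x_error_vanishes e1)
  (filterI (eta_error_vanishes e1) (mu_disagreement_vanishes e1))).
exists T; split=> [|t0 Tt s ts st]; first exact: num_real.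
have t00 : 0 <= t0 by rewrite (le_trans T0) ?ltW.
have acc := ac_curveB_cst (mu t0) acmu.
have := ac_fun_le (C := e / 2) (ac_fun_mdot acc acc) t00 ts.
rewrite subrr mdot0l subr0 => /(_ _)/le_lt_trans; apply; last first.
  by apply: (@le_lt_trans _ _ (e / 2 * 1)); rewrite ?ler_wpM2l ?divr_ge0 ?(ltW e0)//; lra.
move: dynS; apply: ae_imply => u h tu us.
have u0 : 0 <= u by rewrite (le_trans t00).
have [_ hM _] := h u0.
have /= [hXu [hEu hPu]] := hT u (lt_le_trans Tt tu).
rewrite (mdotC (mu' u)).
have bw : mdot (mu u - mu t0) (mu u - mu t0) <= 4 * B.
  have -> : mu u - mu t0 = M u - M t0 by rewrite opprB addrA subrK.
  have [_ b1 _] := hB u u0; have [_ b2 _] := hB t0 t00.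
  have := mdot_ge0 (M u + M t0); move: (M u) (M t0) b1 b2 => p q b1 b2.
  by rewrite !mdot_lin (mdotC q p); lra.
have bm : mdot (mu' u) (mu' u) <= sg * (e / 4).
  rewrite hM; apply: le_trans (sqnorm_multiplier_derivative_le _ _ _ _ _ _) _.
  have eE : sg * (e / 4) = (sg * (e / 4) / c1) * c1 by rewrite divfK// gt_eqF.
  rewrite [leRHS]eE; move: (sg * (e / 4) / c1) e1 hXu hEu hPu => r r0 hXu hEu hPu.
  have a1 := ler_wpM2l (sqr_ge0 k1) (ltW (ltrD hEu hXu)).
  have a2 := ler_wpM2l (mulr_ge0 (sqr_ge0 k2) (sqr_ge0 (spectral_norm L))) (ltW hPu).
  by rewrite /c1; move: (mdot (E u) (E u)) (mdot (X u) (X u)) (mdot (center _) _)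
    a1 a2 => p q v a1 a2; lra.
have y := mdot_young (mu u - mu t0) (mu' u) sg0.
have b1 : sg * mdot (mu u - mu t0) (mu u - mu t0) <= e / 4.
  by apply: le_trans sgB; rewrite ler_wpM2l ?(ltW sg0).
have b2 : sg^-1 * mdot (mu' u) (mu' u) <= e / 4 by rewrite ler_pdivrMl.
by move: y b1 b2; lra.
Qed.

(* If [nuh] violated the saddle inequality at [y], then [|x_i - y|^2] would
   decrease by a fixed amount over unit time intervals starting arbitrarily late,
   although it converges. *)
Lemma multiplier_limit_saddle nuh :
  (forall e T : R, 0 < e -> exists2 t, T < t &
    mdot (mu t - rowcst nuh) (mu t - rowcst nuh) < e) ->
  saddle Omega d f xs nuh.
Proof.
move=> hnu; have [rxs Oxs _] := sx; split=> // i y Oy.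
rewrite leNgt; apply/negP => lt_f.
pose c := f i (row i xs) + mdot nuh (y - row i xs) - f i y.
have c0 : 0 < c by rewrite subr_gt0.
have [g gi] := subgradient_exists (row i xs) (@hf i).
pose w := y - row i xs.
(* [Q] bounds the squared distance from [x_i] to [y] once [mdot (X s) (X s) < 1], and [sg] below is
   the Young weight with [sg * Q = c / 4]. *)
pose Q := 2 * mdot w w + 2.
have Q0 : 0 < Q by rewrite ltr_wpDl// mulr_ge0// mdot_ge0.
pose sg := c / (4 * Q).
have sg0 : 0 < sg by rewrite divr_gt0// mulr_gt0.
have c4 : 0 < c / 4 by rewrite divr_gt0.
have c16 : 0 < c / 16 by rewrite divr_gt0.
(* Two errors of this size, one from the cluster point and one from the drift of [mu], give at most
   [sg * c / 4] for the squared distance from [mu_i] to [nuh]. *)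
have sc : 0 < sg * c / 16 by rewrite divr_gt0// mulr_gt0.
have [d1 d10 hd1] := mdot_small (nuh - g) c4.
have [d2 d20 hd2] := mdot_small w c16.
have [T1 [T10 hT1]] := near_pinfty_ge0 (filterI (filterI (x_error_vanishes d10)
  (x_error_vanishes d20)) (filterI (x_error_vanishes c4) (x_error_vanishes ltr01))).
have [T2 [T20 hT2]] := near_pinfty_ge0 (mu_slowly_varying sc).
have [t0 Tt ht0] := hnu _ (T1 + T2) sc.
have tT1 : T1 < t0 by lra.
have tT2 : T2 < t0 by lra.
have t00 : 0 <= t0 by lra.
have acr := ac_curveB_cst y (ac_curve_row i acx).
have rX s : mdot (row i (X s)) (row i (X s)) <= mdot (X s) (X s) by exact: mdot_row_le.
have t01 : t0 <= t0 + 1 by rewrite lerDl.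
have := ac_fun_le (C := - c) (ac_fun_mdot acr acr) t00 t01.
move=> /(_ _)/wrap[].
  move: dyn; apply: ae_imply => s h ts st.
  have s0 : 0 <= s by lra.
  have [_ /(_ i)[gm gmi hn] _ _] := h s0.
  have /= [[hX1 _] [_ hX2]] := hT1 s (lt_le_trans tT1 ts).
  have b1 : mdot (nuh - g) (row i (X s)) < c / 4.
    by have := hd1 _ (le_lt_trans (rX s) hX1); rewrite ltr_norml => /andP[].
  have bm : mdot (nuh - row i (mu s)) (nuh - row i (mu s)) <= sg * c / 4.
    have h1 := hT2 t0 tT2 s ts st.
    apply: (@le_trans _ _ (mdot (rowcst nuh - mu s) (rowcst nuh - mu s))).
      by have := mdot_row_le (rowcst nuh - mu s) i; rewrite linearB/= row_rowcst.
    have -> : rowcst nuh - mu s = - (mu t0 - rowcst nuh) - (mu s - mu t0).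
      by rewrite !opprB addrA subrK.
    have := mdot_ge0 ((mu t0 - rowcst nuh) - (mu s - mu t0)).
    move: (mu t0 - rowcst nuh) (mu s - mu t0) ht0 h1 => p q ht0 h1.
    by rewrite !mdot_lin (mdotC q p); lra.
  have yx : y - row i (x s) = w - row i (X s).
    by rewrite linearB/= /w opprB addrA subrK.
  have bq : mdot (y - row i (x s)) (y - row i (x s)) <= Q.
    have h1 := le_trans (rX s) (ltW hX2).
    rewrite yx /Q; have := mdot_ge0 (w + row i (X s)).
    by move: (w) (row i (X s)) h1 => p q h1; rewrite !mdot_lin (mdotC q p); lra.
  have b2 : 2 * mdot (y - row i (x s)) (nuh - row i (mu s)) <= c / 2.
    apply: le_trans (mdot_young _ _ sg0) _.
    have b3 : sg * mdot (y - row i (x s)) (y - row i (x s)) <= c / 4.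
      apply: (@le_trans _ _ (sg * Q)); first by rewrite ler_wpM2l ?(ltW sg0).
      rewrite /sg [leLHS](_ : _ = c / 4)//; field; rewrite gt_eqF//.
    have b4 : sg^-1 * mdot (nuh - row i (mu s)) (nuh - row i (mu s)) <= c / 4.
      by rewrite ler_pdivrMl// mulrA.
    by move: b3 b4; lra.
  have := hn y Oy; have := gmi y; have := gi (row i (x s)); rewrite !dotpE.
  have -> : row i (x s) - row i xs = row i (X s) by rewrite linearB.
  have cE' : c = f i (row i xs) + mdot nuh (y - row i (x s)) + mdot nuh (row i (X s)) - f i y.
    rewrite yx /c -/w; congr (_ - _).
    by move: (row i (X s)) (w) => p q; rewrite mdotDr mdotNr; ring.
  have -> : row i (x s) - y = - (y - row i (x s)) by rewrite opprB.
  move: b1 b2 cE'; rewrite (mdotDl nuh) mdotNl => b1.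
  move: (y - row i (x s)) (row i (X s)) b1 => p q b1.
  rewrite !mdotDr !mdotDl !mdotNl !mdotNr (mdotC (row i (x' s)) p).
  rewrite (mdotC p nuh) (mdotC p (row i (mu s))) (mdotC p (row i (x' s))).
  lra.
(* Over the unit window the squared distance should drop by [c], but expanding it around [w] shows
   that it drops by less than [c / 8 + c / 8 + c / 4]. *)
have -> : t0 + 1 - t0 = 1 by ring.
have /= [[_ hA] [hB _]] := hT1 t0 tT1.
have /= [[_ hC] _] := hT1 (t0 + 1) (lt_le_trans tT1 t01).
have := hd2 _ (le_lt_trans (rX _) hA); have := hd2 _ (le_lt_trans (rX _) hC).
have := mdot_ge0 (row i (X (t0 + 1))); have := le_lt_trans (rX _) hB.
have xw s : row i (x s) - y = row i (X s) - w.
  by rewrite linearB/= /w opprB addrA subrK.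
rewrite !xw; move: (w) (row i (X t0)) (row i (X (t0 + 1))) => p q r.
rewrite !ltr_norml => h1 h2 /andP[h3 h4] /andP[h5 h6].
rewrite !mdot_lin (mdotC q p) (mdotC r p); lra.
Qed.

(** [M] is bounded, so it has a cluster point as time grows; its centered part is 0 because the
    disagreement vanishes, so it is a constant [nl], and undoing the shift gives [nu + nl]. *)
Lemma mu_cluster : exists nuh, forall e T : R, 0 < e -> exists2 t, T < t &
  mdot (mu t - rowcst nuh) (mu t - rowcst nuh) < e.
Proof.
have [B B0 hB] := bounded.
have [|l hl] := @bounded_mx_cluster R _ (+oo : set_system R) _ N n M B.
  by exists 0; split=> // t t0; have [] := hB t (ltW t0).
have [nl hnl] : exists nl, l = rowcst nl.
  apply: center_eq0; apply/mdot_eq0/eqP; rewrite eq_le mdot_ge0 andbT.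
  apply/ler_addgt0Pr => e e0; rewrite add0r.
  have e4 : 0 < e / 4 by rewrite divr_gt0.
  have [T [_ hT]] := near_pinfty_ge0 (mu_disagreement_vanishes e4).
  have [|t Tt tl] := hl _ e4 [set t | T < t]; first by exists T; split=> //; exact: num_real.
  have := hT t Tt; have := le_lt_trans (mdot_center_le N0 _) tl.
  rewrite !center_mulmx mulmxBr.
  move: (_ *m M t) (_ *m l) => p q h1 h2.
  by have := mdot_ge0 (2 *: p - q); move: h1 h2; rewrite !mdot_lin (mdotC q p); lra.
exists (nu + nl) => e T e0.
have [|t Tt tl] := hl e e0 [set t | T < t]; first by exists T; split=> //; exact: num_real.
exists t => //; have -> : mu t - rowcst (nu + nl) = M t - l; last exact: tl.
by rewrite hnl; apply/matrixP => i j; rewrite !mxE; ring.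
Qed.

End AtSaddle.

Lemma trajectory_converges xs nu : saddle Omega d f xs nu ->
  (forall e T : R, 0 < e -> exists2 t, T < t &
    mdot (mu t - rowcst nu) (mu t - rowcst nu) < e) ->
  [/\ x t @[t --> +oo] --> xs, mu t @[t --> +oo] --> (rowcst nu : 'M[R]_(N, n))
    & eta t @[t --> +oo] --> xs - dmx].
Proof.
move=> sx hnu.
have V0 (e : R) : 0 < e -> \forall t \near +oo, lyapunov xs nu t < e.
  move=> e0; pose e' := e / (k1 / 2 + 2^-1 + k3^-1).
  have c0 : 0 < k1 / 2 + 2^-1 + k3^-1 by rewrite !addr_gt0 ?invr_gt0 ?divr_gt0.
  have e'0 : 0 < e' by rewrite divr_gt0.
  have [T [T0 hT]] := near_pinfty_ge0
    (filterI (x_error_vanishes sx e'0) (eta_error_vanishes sx e'0)).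
  have [t0 Tt ht] := hnu e' T e'0.
  have [/= hX hE] := hT t0 Tt.
  exists t0; split=> [|t t0t]; first exact: num_real.
  apply: le_lt_trans (lyapunov_nonincreasing sx (ltW (le_lt_trans T0 Tt)) (ltW t0t)) _.
  have -> : e = (k1 / 2 + 2^-1 + k3^-1) * e' by rewrite mulrC divfK// gt_eqF.
  rewrite !mulrDl /lyapunov !ltrD// ltr_pM2l ?invr_gt0 ?divr_gt0//.
have sq (c : R) (A : R -> 'M[R]_(N, n)) a : 0 < c ->
    (forall t, mdot (A t - a) (A t - a) <= c * lyapunov xs nu t) ->
    A t @[t --> +oo] --> a.
  move=> c0 hA; apply: cvg_mx_mdot; apply/cvgrPdist_lt => e e0.
  have := V0 _ (divr_gt0 e0 c0); apply: filterS => t.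
  rewrite sub0r normrN ger0_norm ?mdot_ge0// ltr_pdivlMr// mulrC => h.
  by apply: le_lt_trans (hA t) h.
split.
- by apply: (sq (2 / k1)) => [|t]; [rewrite divr_gt0|have [] := lyapunov_bounds xs nu t].
- by apply: (sq 2) => // t; have [] := lyapunov_bounds xs nu t.
- by apply: (sq k3) => // t; have [] := lyapunov_bounds xs nu t.
Qed.

End Trajectory.

Theorem theorem1 (R : realType) (N n : nat) (hN : (2 <= N)%N) (hn : (1 <= n)%N)
  (G : wdigraph R N)
  (hconn : strongly_connected G) (hbal : weight_balanced G)
  (lam : seq R)
  (hlam : ordered_eigenvalues (2^-1 *: (laplacian G + (laplacian G)^T)) lam)
  (Omega : 'I_N -> set 'rV[R]_n) (d : 'I_N -> 'rV[R]_n)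
  (f : 'I_N -> 'rV[R]_n -> R) (omega : R)
  (hclosed : forall i, closed (Omega i))
  (hconvex : forall i, convex_set (Omega i))
  (hf : forall i, convex_function setT (f i))
  (homega : 0 < omega)
  (hstrong : forall i, strongly_convex_on omega (Omega i) (f i))
  (hslater : slater Omega d)
  (k1 k2 k3 : R)
  (hk1 : spectral_norm (laplacian G) ^+ 2 / (lam`_1 * omega) < k1)
  (hk2 : k1 ^+ 2 / lam`_1 ^+ 2 < k2)
  (hk3 : 0 < k3)
  (x mu eta : R -> 'M[R]_(N, n))
  (htraj : trajectory G Omega f d k1 k2 k3 x mu eta)
  (heta0 : \sum_i row i (eta 0) = 0) :
  (exists xs mus etas : 'M[R]_(N, n),
    [/\ equilibrium G Omega f d k1 k2 k3 xs mus etas,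
        x t @[t --> +oo] --> xs,
        mu t @[t --> +oo] --> mus
      & eta t @[t --> +oo] --> etas]) /\
  (exists xopt : 'M[R]_(N, n),
    unique (optimal Omega f d) xopt /\ x t @[t --> +oo] --> xopt).
Proof.
have N0 : (0 < N)%N by exact: leq_trans hN.
have cf i : convexf (f i) by exact: convex_function_convexf.
have [lam0 gap] := laplacian_gap hN hbal hconn hlam.
have [xs [nu0 s0]] := saddle_exists hclosed hconvex cf homega hstrong hslater.
have [nu hnu] := mu_cluster N0 hbal lam0 (@gap n) hclosed hconvex cf homega hstrong
  hk1 hk2 hk3 htraj heta0 s0.
have snu := multiplier_limit_saddle N0 hbal lam0 (@gap n) hclosed hconvex cf homega
  hstrong hk1 hk2 hk3 htraj heta0 s0 hnu.
have [cx cmu ceta] := trajectory_converges N0 hbal lam0 (@gap n) hclosed hconvex cf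
  homega hstrong hk1 hk2 hk3 htraj heta0 snu hnu.
split; last first.
  by exists xs; split=> //; exact: (saddle_unique_optimal hconvex cf homega hstrong snu).
exists xs, (rowcst nu), (xs - \matrix_i d i); split=> //.
exact: (saddle_equilibrium _ _ _ _ hconvex cf snu).
Qed.
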